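(* The validity problem for the set of $\forall\exists$ sentences over positive word equations in which every variable has at most two occurrences is undecidable. That is, there is no algorithm which decides the following: given a finite alphabet $\Sigma$ and a sentence of the form $\forall X_1\cdots\forall X_k\,\exists Y_1\cdots\exists Y_m\,\varphi$, where $\varphi$ is a positive word-equation formula and each variable occurs at most twice in the sentence, is the sentence true when all variables range over $\Sigma^*$?
   Context: Fix a finite alphabet $\Sigma$. A string term is a string variable, a constant string in $\Sigma^*$, or a concatenation of string terms. A word equation is an atomic formula $t_1 = t_2$, where $t_1,t_2$ are string terms. A positive word-equation formula is a formula built from word equations using only conjunction and disjunction (no negation). String variables range over $\Sigma^*$, and concatenation is interpreted as concatenation of words. *)

(* Defs.v *)
From mathcomp Require Import all_boot.
Set Implicit Arguments.
Unset Strict Implicit.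
Unset Printing Implicit Defensive.

Section WordEquations.
Variables (Sigma : finType) (V : Type).

Inductive sterm :=
| SVar of V
| SConst of seq Sigma
| SCat of sterm & sterm.

Inductive wform :=
| WEq of sterm & sterm
| WAnd of wform & wform
| WOr of wform & wform.

Fixpoint sterm_val (h : V -> seq Sigma) (t : sterm) : seq Sigma :=
  match t with
  | SVar x => h x
  | SConst w => w
  | SCat t1 t2 => sterm_val h t1 ++ sterm_val h t2
  end.

Fixpoint wform_holds (h : V -> seq Sigma) (phi : wform) : Prop :=
  match phi with
  | WEq t1 t2 => sterm_val h t1 = sterm_val h t2
  | WAnd p q => wform_holds h p /\ wform_holds h q
  | WOr p q => wform_holds h p \/ wform_holds h q
  end.

End WordEquations.

Section Occurrences.
Variables (Sigma : finType) (V : eqType).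

Fixpoint sterm_occ (x : V) (t : sterm Sigma V) : nat :=
  match t with
  | SVar y => (y == x)
  | SConst _ => 0
  | SCat t1 t2 => sterm_occ x t1 + sterm_occ x t2
  end.

Fixpoint wform_occ (x : V) (phi : wform Sigma V) : nat :=
  match phi with
  | WEq t1 t2 => sterm_occ x t1 + sterm_occ x t2
  | WAnd p q | WOr p q => wform_occ x p + wform_occ x q
  end.

End Occurrences.

(* A finite alphabet, as an input to an algorithm, is {0, ..., n - 1}.        *)
(* [inl i] is the universal variable X_(i+1), [inr j] is the existential      *)
(* variable Y_(j+1); typing the matrix this way makes the sentence closed.    *)
Record ae_sentence := AESentence {
  ae_alphabet : nat;
  ae_univ : nat;
  ae_exist : nat;
  ae_matrix : wform 'I_ae_alphabet ('I_ae_univ + 'I_ae_exist)%type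
}.

Definition ae_valid (s : ae_sentence) : Prop :=
  forall X : 'I_(ae_univ s) -> seq 'I_(ae_alphabet s),
  exists Y : 'I_(ae_exist s) -> seq 'I_(ae_alphabet s),
    wform_holds
      (fun v => match v with inl i => X i | inr j => Y j end) (ae_matrix s).

(* Occurrences are those in the matrix; the quantifier that binds a variable  *)
(* is not counted.                                                            *)
Definition ae_at_most_twice (s : ae_sentence) : Prop :=
  forall v : 'I_(ae_univ s) + 'I_(ae_exist s), wform_occ v (ae_matrix s) <= 2.

(* Kleene's partial mu-recursive functions, [mrec k] being those of arity k.  *)
(* Primitive recursion is on the first argument:                              *)
(*   h(0, v) = f(v),   h(x+1, v) = g(x, h(x, v), v).                          *)
Inductive mrec : nat -> Type :=
| MZero k : mrec k
| MSucc : mrec 1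
| MProj k : 'I_k -> mrec k
| MComp m k : mrec m -> ('I_m -> mrec k) -> mrec k
| MPrec k : mrec k -> mrec k.+2 -> mrec k.+1
| MMin k : mrec k.+1 -> mrec k.

(* [mcomputes f v r] : f is defined at v, with value r.                       *)
(* In the [MPrec] case, h lists the values of the recursion up to [thead v].  *)
Fixpoint mcomputes k (f : mrec k) : k.-tuple nat -> nat -> Prop :=
  match f in mrec k return k.-tuple nat -> nat -> Prop with
  | MZero _ => fun _ r => r = 0
  | MSucc => fun v r => r = (thead v).+1
  | MProj _ i => fun v r => r = tnth v i
  | MComp m _ f g => fun v r =>
      exists2 w : m.-tuple nat,
        forall i, mcomputes (g i) v (tnth w i) & mcomputes f w r
  | MPrec _ f g => fun v r =>
      exists h : nat -> nat,
        [/\ mcomputes f [tuple of behead v] (h 0),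
            forall i, i < thead v ->
              mcomputes g [tuple of i :: h i :: behead v] (h i.+1)
          & r = h (thead v)]
  | MMin _ f => fun v r =>
      mcomputes f [tuple of r :: v] 0 /\
      forall i, i < r -> exists s, mcomputes f [tuple of i :: v] s.+1
  end.

(* The set P is decided, among the x satisfying D, by a mu-recursive function *)
(* of the code of x; nothing is required of the function on other inputs.     *)
Definition mu_decidable_on (T : Type) (code : T -> nat) (D P : T -> Prop) :
    Prop :=
  exists f : mrec 1, forall x, D x ->
    (P x -> mcomputes f [tuple code x] 1) /\
    (~ P x -> mcomputes f [tuple code x] 0).

(* Cantor's pairing function. *)
Definition cpair (a b : nat) : nat := ((a + b) * (a + b).+1)./2 + b.

Definition code_seq (s : seq nat) : nat :=
  foldr (fun a c => (cpair a c).+1) 0 s.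

Fixpoint code_sterm n k m (t : sterm 'I_n ('I_k + 'I_m)%type) : nat :=
  match t with
  | SVar (inl i) => cpair 0 i
  | SVar (inr j) => cpair 1 j
  | SConst w => cpair 2 (code_seq (map val w))
  | SCat t1 t2 => cpair 3 (cpair (code_sterm t1) (code_sterm t2))
  end.

Fixpoint code_wform n k m (phi : wform 'I_n ('I_k + 'I_m)%type) : nat :=
  match phi with
  | WEq t1 t2 => cpair 0 (cpair (code_sterm t1) (code_sterm t2))
  | WAnd p q => cpair 1 (cpair (code_wform p) (code_wform q))
  | WOr p q => cpair 2 (cpair (code_wform p) (code_wform q))
  end.

Definition code_ae (s : ae_sentence) : nat :=
  cpair (ae_alphabet s)
    (cpair (ae_univ s) (cpair (ae_exist s) (code_wform (ae_matrix s)))).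

Lemma cpair_inj a b c d : cpair a b = cpair c d -> a = c /\ b = d.
Proof.
have triS n : (n.+1 * n.+2)./2 = (n * n.+1)./2 + n.+1.
  have -> : n.+1 * n.+2 = n * n.+1 + n.+1.*2.
    by rewrite -muln2 -[n.+2]addn2 mulnDr [n.+1 * n]mulnC.
  by rewrite halfD odd_double andbF doubleK.
have tri_le i j : i <= j -> (i * i.+1)./2 <= (j * j.+1)./2.
  by move=> le_ij; apply: half_leq; apply: leq_mul.
have lt_absurd x y z t : x + y < z + t -> cpair x y < cpair z t.
  move=> lt_xz; rewrite /cpair.
  apply: leq_trans (leq_addr _ _); apply: leq_trans (tri_le _ _ lt_xz).
  by rewrite triS ltn_add2l ltnS leq_addl.
move=> e; have e_sum : a + b = c + d.
  by case: (ltngtP (a + b) (c + d)) => // /lt_absurd; rewrite e ltnn.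
move: e; rewrite /cpair e_sum => /addnI e_bd.
by split=> //; move: e_sum; rewrite e_bd => /addIn.
Qed.

Lemma code_seq_inj : injective code_seq.
Proof.
by elim=> [|a s IHs] [|b t] //= [] /cpair_inj[-> /IHs ->].
Qed.

Lemma code_sterm_inj n k m : injective (@code_sterm n k m).
Proof.
elim=> [[i|j]|w|t1 IH1 t2 IH2] [[i'|j']|w'|u1 u2] //= /cpair_inj[] //.
- by move=> _ /val_inj ->.
- by move=> _ /val_inj ->.
- by move=> _ /code_seq_inj /(inj_map val_inj) ->.
- by move=> _ /cpair_inj[/IH1 -> /IH2 ->].
Qed.

Lemma code_wform_inj n k m : injective (@code_wform n k m).
Proof.
elim=> [t1 t2|p IHp q IHq|p IHp q IHq] [u1 u2|p' q'|p' q'] //= /cpair_inj[] //.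
- by move=> _ /cpair_inj[/code_sterm_inj -> /code_sterm_inj ->].
- by move=> _ /cpair_inj[/IHp -> /IHq ->].
- by move=> _ /cpair_inj[/IHp -> /IHq ->].
Qed.

Lemma code_ae_inj : injective code_ae.
Proof.
case=> n k m p [n' k' m' p'] /cpair_inj[/= en] /cpair_inj[ek] /cpair_inj[em].
by case: _ / en p' => p'; case: _ / ek p' => p'; case: _ / em p' => p'
  /code_wform_inj ->.
Qed.

(* Main.v *)
From HB Require Import structures.
Require Import Defs.
From mathcomp Require Import all_boot zify.
From Stdlib Require Import Classical.
Set Implicit Arguments.
Unset Strict Implicit.
Unset Printing Implicit Defensive.

(** The proof is a diagonal argument.  To every
    mu-recursive [F] of four arguments corresponds a nondeterministic register
    program with an accepting run on [d] iff [F(d) = 1].  A run is recorded as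
    a word, each register being a block of zeros preceded by a letter naming
    the state and the register.  The sentence says that no word [S] completes
    the initial configuration to an accepting run, because some factor of it
    matches one of finitely many error patterns: a forbidden pair of letters,
    or two blocks of consecutive configurations of wrong relative length,
    [l 0^e A l1 0* l2 0* ... lr A 0^e' l'].

    Occurrences are economised in three ways.  [S] is decomposed once, as
    [P F_1 ... F_N Q], and each disjunct uses its own factor [F_p].  Equality of
    lengths costs the two occurrences of [A], which cannot contain a letter
    because consecutive states differ.  A block [D] skipped by a pattern has to
    lie in [0*], with one occurrence left to say so: a universal [Z] either
    contains a nonzero letter, or is a power of zero, and then it suffices that
    the product of the skipped blocks is prefix-comparable with [Z].

    The numbers (alphabet, variables, code of the fixed part of the matrix)
    describing the sentence of [F] are the input [d] on which [F] is run, and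
    [F] composes the presumed decision function with the map from [d] to the
    code of the sentence with input [d]. *)

(** * Mu-recursive functions *)

Lemma mcomputes_fun k (f : mrec k) v r s :
  mcomputes f v r -> mcomputes f v s -> r = s.
Proof.
elim: f v r s => {k} /=.
- by move=> k v r s -> ->.
- by move=> v r s -> ->.
- by move=> k i v r s -> ->.
- move=> m k f IHf g IHg v r s [w Hw Hr] [w' Hw' Hs].
  have eqw : w = w'.
    by apply: eq_from_tnth => i; apply: IHg (Hw i) (Hw' i).
  by rewrite -eqw in Hs; apply: IHf Hr Hs.
- move=> k f IHf g IHg v r s [h [h0 hS ->]] [h' [h'0 h'S ->]].
  have eqh n : n <= thead v -> h n = h' n.
    elim: n => [_|n IHn lt_n]; first exact: IHf h0 h'0.
    have := h'S n lt_n; rewrite -(IHn (ltnW lt_n)) => h'n.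
    exact: IHg (hS n lt_n) h'n.
  exact: eqh.
- move=> k f IHf v r s [fr ltr] [fs lts].
  case: (ltngtP r s) => // [/lts|/ltr] [t ft].
    by have := IHf _ _ _ fr ft.
  by have := IHf _ _ _ fs ft.
Qed.

Definition mcomputable k (F : k.-tuple nat -> nat) :=
  exists f : mrec k, forall v, mcomputes f v (F v).

Lemma mcomputable_ext k (F G : k.-tuple nat -> nat) :
  F =1 G -> mcomputable F -> mcomputable G.
Proof. by move=> eqFG [f Hf]; exists f => v; rewrite -eqFG. Qed.

Lemma mcomputable_proj k (i : 'I_k) : mcomputable (fun v => tnth v i).
Proof. by exists (MProj i). Qed.

Lemma mcomputable_comp1 k (op : nat -> nat) (F : k.-tuple nat -> nat) :
    mcomputable (fun v : 1.-tuple nat => op (thead v)) -> mcomputable F ->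
  mcomputable (fun v => op (F v)).
Proof.
move=> [o Ho] [f Hf]; exists (MComp o (fun=> f)) => v /=.
exists [tuple F v] => [i|]; first by rewrite (tnth_nth 0) ord1.
exact: (Ho [tuple F v]).
Qed.

Lemma mcomputable_comp2 k (op : nat -> nat -> nat) (F G : k.-tuple nat -> nat) :
    mcomputable (fun v : 2.-tuple nat => op (tnth v ord0) (tnth v ord_max)) ->
    mcomputable F -> mcomputable G ->
  mcomputable (fun v => op (F v) (G v)).
Proof.
move=> [o Ho] [f Hf] [g Hg].
exists (MComp o (fun i : 'I_2 => if i == ord0 then f else g)) => v /=.
exists [tuple F v; G v]; last exact: (Ho [tuple F v; G v]).
by case=> [[|[|i]] Hi] //=; rewrite (tnth_nth 0).
Qed.

Lemma mcomputable_succ k (F : k.-tuple nat -> nat) :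
  mcomputable F -> mcomputable (fun v => (F v).+1).
Proof. by apply: mcomputable_comp1; exists MSucc. Qed.

Lemma mcomputable_const k c : mcomputable (fun _ : k.-tuple nat => c).
Proof.
elim: c => [|c IHc]; first by exists (MZero k).
exact: (mcomputable_succ IHc).
Qed.

Lemma mcomputable_iter c (G : nat -> nat -> nat) :
    mcomputable (fun v : 2.-tuple nat => G (tnth v ord0) (tnth v ord_max)) ->
  mcomputable (fun v : 1.-tuple nat => iteri (thead v) G c).
Proof.
move=> [g Hg]; have [f Hf] := mcomputable_const 0 c.
exists (MPrec f g) => v /=; exists (fun n => iteri n G c).
by split=> // i lt_i; apply: (Hg [tuple of i :: _ :: behead v]).
Qed.

Lemma mcomputable_add k (F G : k.-tuple nat -> nat) :
  mcomputable F -> mcomputable G -> mcomputable (fun v => F v + G v).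
Proof.
apply: mcomputable_comp2.
(* The step function receives [(i, h i, y)]; index 1 selects the previous value. *)
exists (MPrec (MProj ord0) (MComp MSucc (fun=> MProj (Ordinal (isT : 1 < 3))))).
move=> v /=; exists (fun n => n + tnth v ord_max); split=> [|i lt_i|].
- by rewrite !(tnth_nth 0) /= nth_behead.
- exists [tuple i + tnth v ord_max] => // j; by rewrite ord1 !(tnth_nth 0).
- by [].
Qed.

(** A triangular number is an iterated sum, so the pairing can be computed without halving. *)
Lemma cpair_iteri a b :
  cpair a b = iteri (a + b) (fun n t => t + n.+1) 0 + b.
Proof.
rewrite /cpair; congr (_ + b); elim: (a + b) => [//|n IHn]; rewrite [RHS]/= -IHn.
have -> : n.+1 * n.+2 = n * n.+1 + n.+1.*2 by lia.
by rewrite halfD odd_double andbF doubleK.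
Qed.

Lemma mcomputable_cpair k (F G : k.-tuple nat -> nat) :
  mcomputable F -> mcomputable G -> mcomputable (fun v => cpair (F v) (G v)).
Proof.
move=> HF HG.
apply: (@mcomputable_ext _
  (fun v => iteri (F v + G v) (fun n t => t + n.+1) 0 + G v)) => [v|].
  by rewrite cpair_iteri.
apply: mcomputable_add => //.
apply: (@mcomputable_comp1 _ (fun n => iteri n (fun n t => t + n.+1) 0)); last first.
  exact: mcomputable_add.
apply: (mcomputable_iter 0 (G := fun n t => t + n.+1)).
apply: mcomputable_add; last apply: mcomputable_succ; exact: mcomputable_proj.
Qed.

(** Runs of zeros are the only constants of the sentence that depend on the input. *)
Lemma mcomputable_code_nseq k (F : k.-tuple nat -> nat) :
  mcomputable F -> mcomputable (fun v => code_seq (nseq (F v) 0)).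
Proof.
move=> HF; apply: (@mcomputable_ext _
  (fun v => iteri (F v) (fun _ c => (cpair 0 c).+1) 0)) => [v|].
  by elim: (F v) => //= n ->.
apply: (@mcomputable_comp1 _ (fun n => iteri n (fun _ c => (cpair 0 c).+1) 0)) => //.
apply: (mcomputable_iter 0 (G := fun _ c => (cpair 0 c).+1)).
apply: mcomputable_succ; apply: mcomputable_cpair.
  exact: mcomputable_const.
exact: mcomputable_proj.
Qed.

(** * Register programs *)

(** A single relational assignment covers copying, increment and decrement; with [c] true and [d]
    false it blocks when the source is zero. Relating new to old contents is what error patterns can
    check. *)
Inductive atom := ASet of nat & nat & bool & bool | ATest of nat & nat.
Inductive cmd := CAtom of atom | CSeq of cmd & cmd | CStar of cmd.

Definition store := nat -> nat.

Definition atom_sem (a : atom) (m m' : store) : Prop :=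
  match a with
  | ASet i j c d => m' i + c = m j + d /\ forall l, l != i -> m' l = m l
  | ATest i j => m i = m j /\ forall l, m' l = m l
  end.

(** A star runs its body a guessed number of times; in compiled programs a wrong guess is caught by
    a later test or a blocked decrement. *)
Inductive exec : cmd -> store -> store -> Prop :=
| ExAtom a m m' of atom_sem a m m' : exec (CAtom a) m m'
| ExSeq c d m m1 m' of exec c m m1 & exec d m1 m' : exec (CSeq c d) m m'
| ExStop c m : exec (CStar c) m m
| ExLoop c m m1 m' of exec c m m1 & exec (CStar c) m1 m' :
    exec (CStar c) m m'.

Definition cskip := CAtom (ATest 0 0).
Definition cseq (cs : seq cmd) := foldr CSeq cskip cs.

Lemma exec_atom a m m' : exec (CAtom a) m m' <-> atom_sem a m m'.
Proof. by split=> [H|]; [inversion H | apply: ExAtom]. Qed.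

Lemma exec_seq c d m m' :
  exec (CSeq c d) m m' <-> exists2 m1, exec c m m1 & exec d m1 m'.
Proof.
split=> [H|[m1 H1 H2]]; last exact: ExSeq H1 H2.
by inversion H; subst; exists m1.
Qed.

Lemma exec_star_inv (I : store -> Prop) c m m' :
    (forall m1 m2, I m1 -> exec c m1 m2 -> I m2) ->
  exec (CStar c) m m' -> I m -> I m'.
Proof.
move=> Ic H; move E: (CStar c) H => d H.
by elim: H E => // {}d {}m m1 {}m' H1 _ _ IH [eqd] Im; subst d; apply: IH (Ic _ _ Im H1).
Qed.

Lemma exec_star_rcons c m m1 m' :
  exec (CStar c) m m1 -> exec c m1 m' -> exec (CStar c) m m'.
Proof.
move=> H H1; move E: (CStar c) H => d H.
elim: H E H1 => // {}d {}m.
  by move=> [eqd] H1; subst d; apply: ExLoop H1 (ExStop _ _).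
move=> m2 m3 H2 _ _ IH [eqd] H1; subst d; apply: ExLoop H2 _.
exact: IH.
Qed.

Definition upd (m : store) i v : store := fun l => if l == i then v else m l.

Lemma atom_upd i j (c d : bool) m v :
  v + c = m j + d -> atom_sem (ASet i j c d) m (upd m i v).
Proof. by rewrite /= /upd eqxx; split=> // l /negbTE->. Qed.

(* Register 0 is a constant zero; [xs] are the argument registers, [r] the    *)
(* result register, and all registers from [b] on are scratch.                *)
Fixpoint compile k (f : mrec k) : k.-tuple nat -> nat -> nat -> cmd :=
  match f in mrec k return k.-tuple nat -> nat -> nat -> cmd with
  | MZero _ => fun _ r _ => CAtom (ASet r 0 false false)
  | MSucc => fun xs r _ => CAtom (ASet r (thead xs) false true)
  | MProj _ i => fun xs r _ => CAtom (ASet r (tnth xs i) false false)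
  | MComp n _ f g => fun xs r b =>
      CSeq (cseq [seq compile (g i) xs (b + i) (b + n) | i <- enum 'I_n])
           (compile f [tuple b + i | i < n] r (b + n))
  | MPrec _ f g => fun xs r b =>
      cseq [:: CAtom (ASet b 0 false false);
               compile f [tuple of behead xs] b.+1 b.+3;
               CStar (cseq
                 [:: compile g [tuple of b :: b.+1 :: behead xs] b.+2 b.+3;
                     CAtom (ASet b.+1 b.+2 false false);
                     CAtom (ASet b b false true)]);
               CAtom (ATest b (thead xs));
               CAtom (ASet r b.+1 false false)]
  | MMin _ f => fun xs r b =>
      cseq [:: CAtom (ASet b 0 false false);
               CStar (cseq
                 [:: compile f [tuple of b :: xs] b.+1 b.+2;
                     CAtom (ASet b.+1 b.+1 true false);
                     CAtom (ASet b b false true)]);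
               compile f [tuple of b :: xs] b.+1 b.+2;
               CAtom (ATest b.+1 0);
               CAtom (ASet r b false false)]
  end.

Definition result_in b r (m m' : store) v :=
  m' r = v /\ forall l, l < b -> l != r -> m' l = m l.

(** Programs are nondeterministic, hence two halves: every completed execution yields the value, and
    some execution completes if there is a value. Where the function is undefined, no execution
    completes. *)
Definition compile_spec k (f : mrec k) :=
  forall (xs : k.-tuple nat) r b m, 0 < r < b -> all (ltn^~ b) xs ->
    r \notin xs -> m 0 = 0 ->
  (forall m', exec (compile f xs r b) m m' ->
     exists2 v, mcomputes f [tuple of map m xs] v & result_in b r m m' v) /\
  (forall v, mcomputes f [tuple of map m xs] v ->
     exists2 m', exec (compile f xs r b) m m' & result_in b r m m' v).

Lemma compile_specA k (f : mrec k) (xs : k.-tuple nat) r j (d : bool) b :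
    (forall m, mcomputes f [tuple of map m xs] (m j + d)) ->
    (compile f xs r b = CAtom (ASet r j false d)) ->
  forall m,
  (forall m', exec (compile f xs r b) m m' ->
     exists2 v, mcomputes f [tuple of map m xs] v & result_in b r m m' v) /\
  (forall v, mcomputes f [tuple of map m xs] v ->
     exists2 m', exec (compile f xs r b) m m' & result_in b r m m' v).
Proof.
move=> Hf -> m; split=> [m' /exec_atom /= [e1 e2]|v fv].
  exists (m j + d) => //; split=> [|l _ /e2 //]; by rewrite -e1 addn0.
exists (upd m r v).
  apply: ExAtom; apply: atom_upd; rewrite addn0.
  exact: mcomputes_fun fv (Hf m).
by split=> [|l _ /negbTE nlr]; rewrite /upd ?eqxx ?nlr.
Qed.

Lemma map_tuple_eq k (xs : k.-tuple nat) (m m' : store) :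
  {in xs, m =1 m'} -> [tuple of map m xs] = [tuple of map m' xs].
Proof. by move=> eqm; apply: val_inj; apply/eq_in_map. Qed.

(** Induction on the programs still to be run. The clause of [F] on indices outside [s] protects the
    results already stored; scratch registers start only at [b + n]. *)
Lemma compile_cseq b n k (g : 'I_n -> mrec k) (xs : k.-tuple nat) :
    0 < b -> all (ltn^~ b) xs -> (forall i, compile_spec (g i)) ->
  forall s : seq 'I_n, uniq s -> forall m, m 0 = 0 ->
  let c := cseq [seq compile (g i) xs (b + i) (b + n) | i <- s] in
  let F (m' : store) := (forall l, l < b -> m' l = m l) /\
    (forall i, i \notin s -> m' (b + i) = m (b + val i)) in
  (forall m', exec c m m' -> F m' /\
     forall i, i \in s -> mcomputes (g i) [tuple of map m xs] (m' (b + i))) /\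
  (forall w : 'I_n -> nat,
     (forall i, i \in s -> mcomputes (g i) [tuple of map m xs] (w i)) ->
     exists2 m', exec c m m' & F m' /\ forall i, i \in s -> m' (b + i) = w i).
Proof.
move=> b0 ltxs Hg; elim=> [|i s IHs] /=.
  move=> _ m m0; split=> [m' /exec_atom /= [_ e]|w _].
    by split=> //; split.
  by exists m => //; apply: ExAtom.
case/andP=> nis us m m0.
have ltb := ltn_ord i.
have xs_lt x : x \in xs -> x < b by move/allP: ltxs; apply.
have Hall : all (ltn^~ (b + n)) xs.
  by apply/allP=> x /xs_lt /=; lia.
have Hnot : b + i \notin xs by apply/negP=> /xs_lt; lia.
have Hrb : 0 < b + i < b + n by lia.
have [Hi1 Hi2] := Hg i xs (b + i) (b + n) m Hrb Hall Hnot m0.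
split.
- move=> m' /exec_seq[m1 /Hi1[v gv [e1 e2]]].
  have m10 : m1 0 = 0 by rewrite e2 //; lia.
  have eqm : [tuple of map m1 xs] = [tuple of map m xs].
    by apply: map_tuple_eq => x /xs_lt ltx; apply: e2; lia.
  case: (IHs us m1 m10) => H _ /H {H} [[F1 F2] F3].
  split; first split.
  + by move=> l ltl; rewrite F1 // e2 //; lia.
  + move=> j; rewrite inE negb_or => /andP[nji njs].
    have ltj := ltn_ord j.
    by rewrite F2 // e2 ?eqn_add2l // ltn_add2l.
  + move=> j; rewrite inE => /predU1P[->|js].
      by rewrite F2 // e1.
    by rewrite -eqm; apply: F3.
- move=> w Hw; have [|m1 ex1 [e1 e2]] := Hi2 (w i).
    by apply: Hw; rewrite mem_head.
  have m10 : m1 0 = 0 by rewrite e2 //; lia.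
  have eqm : [tuple of map m1 xs] = [tuple of map m xs].
    by apply: map_tuple_eq => x /xs_lt ltx; apply: e2; lia.
  case: (IHs us m1 m10) => _ /(_ w) [j js|m' ex' [[F1 F2] F3]].
    by rewrite eqm; apply: Hw; rewrite inE js orbT.
  exists m'; first exact: ExSeq ex1 ex'.
  split; first split.
  + by move=> l ltl; rewrite F1 // e2 //; lia.
  + move=> j; rewrite inE negb_or => /andP[nji njs].
    have ltj := ltn_ord j.
    by rewrite F2 // e2 ?eqn_add2l // ltn_add2l.
  + move=> j; rewrite inE => /predU1P[->|js]; last exact: F3.
    by rewrite F2.
Qed.

Lemma compile_comp n k (f : mrec n) (g : 'I_n -> mrec k) :
  compile_spec f -> (forall i, compile_spec (g i)) -> compile_spec (MComp f g).
Proof.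
move=> Hf Hg xs r b m /andP[r0 ltr] ltxs nrxs m0.
have b0 : 0 < b by lia.
have [Hs1 Hs2] := compile_cseq b0 ltxs Hg (enum_uniq 'I_n) m0.
have Hrb : 0 < r < b + n by lia.
set ys := [tuple b + i | i < n].
have Hall : all (ltn^~ (b + n)) ys.
  by apply/allP=> _ /mapP[i _ ->] /=; rewrite ltn_add2l.
have Hnot : r \notin ys by apply/negP=> /mapP[i _ e]; lia.
split.
- move=> m' /exec_seq[m1 /Hs1[[F1 _] F2] H].
  have m10 : m1 0 = 0 by rewrite F1.
  have [Hf1 _] := Hf ys r (b + n) m1 Hrb Hall Hnot m10.
  have [v fv [e1 e2]] := Hf1 _ H.
  exists v.
    exists [tuple of map m1 ys] => // i.
    by rewrite tnth_map tnth_mktuple; apply: F2; rewrite mem_enum.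
  by split=> // l ltl nlr; rewrite e2 ?F1 //; lia.
- move=> v [w gw fw].
  have [i _|m1 ex1 [[F1 _] F2]] := Hs2 (tnth w); first exact: gw.
  have m10 : m1 0 = 0 by rewrite F1.
  have [_ Hf2] := Hf ys r (b + n) m1 Hrb Hall Hnot m10.
  have eqw : [tuple of map m1 ys] = w.
    apply: eq_from_tnth => i; rewrite tnth_map tnth_mktuple.
    by apply: F2; rewrite mem_enum.
  have [|m' ex' [e1 e2]] := Hf2 v; first by rewrite eqw.
  exists m'; first exact: ExSeq ex1 ex'.
  by split=> // l ltl nlr; rewrite e2 ?F1 //; lia.
Qed.

Lemma exec_cskip m : exec cskip m m.
Proof. exact: ExAtom. Qed.

(** Register [b] counts the rounds, [b.+1] holds the current value and [b.+2] receives the next one.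
    The test after the loop compares the guessed number of rounds with the recursion argument. *)
Lemma compile_prec k (f : mrec k) (g : mrec k.+2) :
  compile_spec f -> compile_spec g -> compile_spec (MPrec f g).
Proof.
move=> Hf Hg xs r b m /andP[r0 ltr] ltxs nrxs m0.
have xs_lt x : x \in xs -> x < b by move/allP: ltxs; apply.
have xs'_lt x : x \in behead xs -> x < b by move/mem_behead/xs_lt.
pose ys := [tuple of behead xs]; pose zs := [tuple of b :: b.+1 :: behead xs].
have th_lt : thead xs < b by apply: xs_lt; rewrite mem_tnth.
have ys_lt : all (ltn^~ b.+3) ys by apply/allP=> x /xs'_lt /=; lia.
have ysN : b.+1 \notin ys by apply/negP=> /xs'_lt; lia.
have zs_lt : all (ltn^~ b.+3) zs.
  by apply/allP=> x; rewrite !inE /= => /or3P[/eqP->|/eqP->|/xs'_lt]; lia.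
have zsN : b.+2 \notin zs.
  by apply/negP; rewrite !inE /= => /or3P[/eqP|/eqP|/xs'_lt]; lia.
pose v0 := [tuple of map m ys].
have zsE (m1 : store) : (forall l, l < b -> m1 l = m l) ->
  [tuple of map m1 zs] = [tuple of m1 b :: m1 b.+1 :: v0].
  move=> eqm; apply: val_inj; congr (_ :: _ :: _).
  by apply/eq_in_map=> x /xs'_lt; apply: eqm.
have beE : [tuple of behead [tuple of map m xs]] = v0.
  by apply: val_inj; rewrite /= behead_map.
have be2E i x : [tuple of i :: x :: behead [tuple of map m xs]] =
    [tuple of i :: x :: v0].
  by apply: val_inj; rewrite /= behead_map.
have thE : thead [tuple of map m xs] = m (thead xs) by rewrite /thead tnth_map.
pose m1 := upd m b 0.
have m1E l : l < b -> m1 l = m l by move=> ltl; rewrite /m1 /upd; case: eqP => //; lia.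
have ysE (m2 : store) : (forall l, l < b -> m2 l = m l) -> [tuple of map m2 ys] = v0.
  by move=> eqm; apply: map_tuple_eq => x /xs'_lt; apply: eqm.
have rng1 : 0 < b.+1 < b.+3 by lia.
have rng2 : 0 < b.+2 < b.+3 by lia.
pose good n (h : nat -> nat) := mcomputes f v0 (h 0) /\
   forall i, i < n -> mcomputes g [tuple of i :: h i :: v0] (h i.+1).
have gP n h : good n h ->
    forall v, (v = h n) -> n = thead [tuple of map m xs] ->
    mcomputes (MPrec f g) [tuple of map m xs] v.
  move=> [h0 hS] v -> en; exists h; rewrite beE -en; split=> // i lti.
  by rewrite be2E; apply: hS.
split.
- move=> m' /= /exec_seq[m2 /exec_atom /= [e1 e2]].
  rewrite m0 !addn0 in e1.
  have m2E l : l < b -> m2 l = m l by move=> ltl; apply: e2; lia.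
  have m20 : m2 0 = 0 by rewrite m2E //; lia.
  case/exec_seq=> m3; have [H _] := Hf ys b.+1 b.+3 m2 rng1 ys_lt ysN m20.
  case/H=> {H} v1; rewrite ysE // => fv1 [e3 e4].
  (* Loop invariant: [h] satisfies the recursion up to the counter, and [b.+1] holds its value
     there. *)
  pose I (m3 : store) := (forall l, l < b -> m3 l = m l) /\
    exists2 h, good (m3 b) h & m3 b.+1 = h (m3 b).
  have Im3 : I m3.
    split=> [l ltl|]; first by rewrite e4 ?m2E //; lia.
    have -> : m3 b = 0 by rewrite e4 //; lia.
    by exists (fun=> v1).
  case/exec_seq=> m4 Hstar.
  have {Hstar} [m4E [h hgood m4h]] : I m4.
    apply: exec_star_inv Hstar Im3 => {m4} {e3 e4 m3}.
    move=> m3 m7 [m3E [h hgood m3h]] /exec_seq[m4].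
    have m30 : m3 0 = 0 by rewrite m3E //; lia.
    have [H _] := Hg zs b.+2 b.+3 m3 rng2 zs_lt zsN m30.
    case/H=> {H} v; rewrite zsE // => gv [e3 e4].
    case/exec_seq=> m5 /exec_atom /= [e5 e6].
    case/exec_seq=> m6 /exec_atom /= [e7 e8] /exec_atom /= [_ e9].
    rewrite !addn0 in e5 e7.
    split=> [l ltl|].
      by rewrite e9 e8 ?e6 ?e4 ?m3E //; lia.
    have m7b : m7 b = (m3 b).+1 by rewrite e9 e7 e6 ?e4 ?addn1 //; lia.
    have m7b1 : m7 b.+1 = v by rewrite e9 e8 ?e5 ?e3 //; lia.
    case: hgood => h0 hS.
    (* The new [h] continues the old one by the value [v] just computed. *)
    exists (fun i => if i <= m3 b then h i else v); last first.
      by rewrite m7b m7b1 ltnn.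
    rewrite m7b; split=> [//|i]; rewrite ltnS => lei; rewrite lei.
    case: ltnP => [lti|gei]; first exact: hS.
    have -> : i = m3 b by lia.
    by rewrite -m3h.
  case/exec_seq=> m5 /exec_atom /= [e5 e6].
  case/exec_seq=> m6 /exec_atom /= [e7 e8] /exec_atom /= [_ e9].
  exists (m' r).
    apply: (gP _ _ hgood); last by rewrite e5 m4E ?thE.
    by rewrite e9 -m4h; rewrite !addn0 in e7; rewrite e7 e6.
  by split=> // l ltl nlr; rewrite e9 e8 // e6 m4E.
- move=> v /= [h [h0 hS ->]]; rewrite beE in h0; rewrite thE in hS *.
  have {}hS i : i < m (thead xs) -> mcomputes g [tuple of i :: h i :: v0] (h i.+1).
    by move=> lti; rewrite -be2E; apply: hS.
  have m10 : m1 0 = 0 by rewrite m1E //; lia.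
  have [_ H] := Hf ys b.+1 b.+3 m1 rng1 ys_lt ysN m10.
  have [|m2 ex2 [e1 e2]] := H (h 0); first by rewrite ysE.
  pose J n (m3 : store) := [/\ forall l, l < b -> m3 l = m l, m3 b = n & m3 b.+1 = h n].
  pose c := CStar (cseq
                 [:: compile g [tuple of b :: b.+1 :: behead xs] b.+2 b.+3;
                     CAtom (ASet b.+1 b.+2 false false);
                     CAtom (ASet b b false true)]).
  have star n : n <= m (thead xs) -> exists2 m3, exec c m2 m3 & J n m3.
    elim: n => [_|n IHn ltn].
      exists m2; first exact: ExStop.
      split=> // [l ltl|]; first by rewrite e2 ?m1E //; lia.
      by rewrite e2 /m1 /upd ?eqxx //; lia.
    have [m3 ex3 [J1 J2 J3]] := IHn (ltnW ltn).
    have m30 : m3 0 = 0 by rewrite J1 //; lia.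
    have [_ {}H] := Hg zs b.+2 b.+3 m3 rng2 zs_lt zsN m30.
    have [|m4 ex4 [e3 e4]] := H (h n.+1).
      by rewrite zsE // J2 J3; apply: hS.
    pose m5 := upd m4 b.+1 (h n.+1); pose m6 := upd m5 b n.+1.
    have m5b : m5 b = n by rewrite /m5 /upd; case: eqP => [|_]; [lia | rewrite e4 //; lia].
    exists m6.
      apply: exec_star_rcons ex3 _.
      apply/exec_seq; exists m4 => //.
      apply/exec_seq; exists m5.
        by apply: ExAtom; apply: atom_upd; rewrite e3.
      apply/exec_seq; exists m6; last exact: exec_cskip.
      by apply: ExAtom; apply: atom_upd; rewrite m5b addn0 addn1.
    split.
    + move=> l ltl; rewrite /m6 /m5 /upd.
      by do 2 (case: eqP => [|_]; first lia); rewrite e4 ?J1 //; lia.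
    + by rewrite /m6 /upd eqxx.
    + by rewrite /m6 /m5 /upd eqxx; case: eqP => //; lia.
  have [m3 ex3 [J1 J2 J3]] := star _ (leqnn _).
  exists (upd m3 r (h (m (thead xs)))).
    apply/exec_seq; exists m1; first by apply: ExAtom; apply: atom_upd; rewrite m0.
    apply/exec_seq; exists m2 => //.
    apply/exec_seq; exists m3 => //.
    apply/exec_seq; exists m3; first by apply: ExAtom; rewrite /= J2 J1.
    apply/exec_seq; exists (upd m3 r (h (m (thead xs)))); last exact: exec_cskip.
    by apply: ExAtom; apply: atom_upd; rewrite J3.
  by split=> [|l ltl /negbTE nlr]; rewrite /upd ?eqxx ?nlr ?J1.
Qed.

(** Each round decrements the value just computed, which is impossible at zero; a completed round
    thus certifies a positive value at the current counter. The test after the loop certifies the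
    final zero. *)
Lemma compile_min k (f : mrec k.+1) : compile_spec f -> compile_spec (MMin f).
Proof.
move=> Hf xs r b m /andP[r0 ltr] ltxs nrxs m0.
have xs_lt x : x \in xs -> x < b by move/allP: ltxs; apply.
pose zs := [tuple of b :: xs].
have zs_lt : all (ltn^~ b.+2) zs.
  by apply/allP=> x; rewrite !inE /= => /orP[/eqP->|/xs_lt]; lia.
have zsN : b.+1 \notin zs.
  by apply/negP; rewrite !inE /= => /orP[/eqP|/xs_lt]; lia.
pose v0 := [tuple of map m xs].
have zsE (m1 : store) : (forall l, l < b -> m1 l = m l) ->
  [tuple of map m1 zs] = [tuple of m1 b :: v0].
  move=> eqm; apply: val_inj; congr (_ :: _).
  by apply/eq_in_map=> x /xs_lt; apply: eqm.
have rng : 0 < b.+1 < b.+2 by lia.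
pose body := cseq [:: compile f [tuple of b :: xs] b.+1 b.+2;
                     CAtom (ASet b.+1 b.+1 true false);
                     CAtom (ASet b b false true)].
pose I (m1 : store) := (forall l, l < b -> m1 l = m l) /\
    forall i, i < m1 b -> exists s, mcomputes f [tuple of i :: v0] s.+1.
split.
- move=> m' /= /exec_seq[m1 /exec_atom /= [e1 e2]].
  rewrite m0 !addn0 in e1.
  have Im1 : I m1.
    by split=> [l ltl|i]; [apply: e2; lia | rewrite e1].
  case/exec_seq=> m2 Hstar.
  have {Hstar} [m2E m2I] : I m2.
    apply: exec_star_inv Hstar Im1 => {m2} {e1 e2 m1}.
    move=> m1 m5 [m1E m1I] /exec_seq[m2].
    have m10 : m1 0 = 0 by rewrite m1E //; lia.
    have [H _] := Hf zs b.+1 b.+2 m1 rng zs_lt zsN m10.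
    case/H=> {H} v; rewrite zsE // => fv [e3 e4].
    case/exec_seq=> m3 /exec_atom /= [e5 e6].
    case/exec_seq=> m4 /exec_atom /= [e7 e8] /exec_atom /= [_ e9].
    rewrite !addn0 ?addn1 in e5 e7.
    split=> [l ltl|i].
      by rewrite e9 e8 ?e6 ?e4 ?m1E //; lia.
    have -> : m5 b = (m1 b).+1 by rewrite e9 e7 e6 ?e4 //; lia.
    rewrite ltnS leq_eqVlt => /predU1P[->|]; last exact: m1I.
    by exists (m3 b.+1); rewrite e5 e3.
  case/exec_seq=> m3.
  have m20 : m2 0 = 0 by rewrite m2E //; lia.
  have [H _] := Hf zs b.+1 b.+2 m2 rng zs_lt zsN m20.
  case/H=> {H} v; rewrite zsE // => fv [e3 e4].
  case/exec_seq=> m4 /exec_atom /= [e5 e6].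
  case/exec_seq=> m5 /exec_atom /= [e7 e8] /exec_atom /= [_ e9].
  rewrite !addn0 in e7.
  have m30 : m3 0 = 0 by rewrite e4 ?m20 //; lia.
  have v0E : v = 0 by rewrite -e3 e5 m30.
  have m'r : m' r = m2 b by rewrite e9 e7 e6 e4 //; lia.
  exists (m' r).
    by rewrite m'r; split; rewrite -/v0 ?v0E // -v0E.
  by split=> // l ltl nlr; rewrite e9 e8 // e6 e4 ?m2E //; lia.
- move=> v /= [fv fi].
  pose m1 := upd m b 0.
  have m1E l : l < b -> m1 l = m l by move=> ltl; rewrite /m1 /upd; case: eqP => //; lia.
  have m1b : m1 b = 0 by rewrite /m1 /upd eqxx.
  have star n : n <= v -> exists2 m3, exec (CStar body) m1 m3 &
     (forall l, l < b -> m3 l = m l) /\ m3 b = n.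
    elim: n => [_|n IHn ltn].
      by exists m1; first exact: ExStop.
    have [m3 ex3 [J1 J2]] := IHn (ltnW ltn).
    have m30 : m3 0 = 0 by rewrite J1 //; lia.
    have [_ H] := Hf zs b.+1 b.+2 m3 rng zs_lt zsN m30.
    have [s fs] := fi n ltn.
    have [|m4 ex4 [e3 e4]] := H s.+1; first by rewrite zsE // J2.
    pose m5 := upd m4 b.+1 s; pose m6 := upd m5 b n.+1.
    have m5b : m5 b = n by rewrite /m5 /upd; case: eqP => [|_]; [lia | rewrite e4 //; lia].
    exists m6.
      apply: exec_star_rcons ex3 _.
      apply/exec_seq; exists m4 => //.
      apply/exec_seq; exists m5.
        by apply: ExAtom; apply: atom_upd; rewrite e3 addn0 addn1.
      apply/exec_seq; exists m6; last exact: exec_cskip.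
      by apply: ExAtom; apply: atom_upd; rewrite m5b addn0 addn1.
    split; last by rewrite /m6 /upd eqxx.
    move=> l ltl; rewrite /m6 /m5 /upd.
    by do 2 (case: eqP => [|_]; first lia); rewrite e4 ?J1 //; lia.
  have [m3 ex3 [J1 J2]] := star _ (leqnn _).
  have m30 : m3 0 = 0 by rewrite J1 //; lia.
  have [_ H] := Hf zs b.+1 b.+2 m3 rng zs_lt zsN m30.
  have [|m4 ex4 [e3 e4]] := H 0; first by rewrite zsE // J2.
  exists (upd m4 r v).
    apply/exec_seq; exists m1; first by apply: ExAtom; apply: atom_upd; rewrite m0.
    apply/exec_seq; exists m3 => //.
    apply/exec_seq; exists m4 => //.
    apply/exec_seq; exists m4.
      by apply: ExAtom; rewrite /= e3 e4 ?m30 //; lia.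
    apply/exec_seq; exists (upd m4 r v); last exact: exec_cskip.
    by apply: ExAtom; apply: atom_upd; rewrite e4 ?J2 //; lia.
  split=> [|l ltl /negbTE nlr]; rewrite /upd ?eqxx ?nlr //.
  by rewrite e4 ?J1 //; lia.
Qed.

Lemma compileP k (f : mrec k) : compile_spec f.
Proof.
elim: f => {k} [k||k i|n k f IHf g IHg|k f IHf g IHg|k f IHf].
- move=> xs r b m _ _ _ m0; split=> [m' /exec_atom /= [e1 e2]|v /= ->].
    by exists 0 => //; split=> [|l _ /e2 //]; rewrite m0 !addn0 in e1.
  exists (upd m r 0); first by apply: ExAtom; apply: atom_upd; rewrite m0.
  by split=> [|l _ /negbTE nlr]; rewrite /upd ?eqxx ?nlr.
- move=> xs r b m _ _ _ _.
  by apply: (@compile_specA _ _ _ _ (thead xs) true) => // m1; rewrite /= addn1 /thead tnth_map.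
- move=> xs r b m _ _ _ _.
  by apply: (@compile_specA _ _ _ _ (tnth xs i) false) => // m1; rewrite /= addn0 tnth_map.
- exact: compile_comp.
- exact: compile_prec.
- exact: compile_min.
Qed.

(** * Finite control *)

Lemma atom_comparable : comparable atom.
Proof. move=> x y; rewrite /decidable; repeat decide equality. Defined.
HB.instance Definition _ := comparableMixin atom_comparable.

Lemma cmd_comparable : comparable cmd.
Proof. move=> x y; rewrite /decidable; decide equality; exact: atom_comparable. Defined.
HB.instance Definition _ := comparableMixin cmd_comparable.

(** Stores are functions known only up to pointwise equality; this replaces functional
    extensionality. *)
Lemma exec_ext c m m' m1 :
  exec c m m' -> m1 =1 m -> exists2 m1', exec c m1 m1' & m1' =1 m'.
Proof.
move=> H; elim: H m1 => {c m m'}.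
- move=> [i j c d|i j] m m' [e1 e2] m1 eqm; exists m' => //; apply: ExAtom.
    by split=> [|l nl]; rewrite ?eqm ?e1 ?e2.
  by split=> [|l]; rewrite !eqm ?e1 ?e2.
- move=> c d m m2 m' _ IHc _ IHd m1 /IHc[m3 ex3 /IHd[m4 ex4 eq4]].
  by exists m4 => //; apply: ExSeq ex3 ex4.
- by move=> c m m1 eqm; exists m1 => //; apply: ExStop.
- move=> c m m2 m' _ IHc _ IHd m1 /IHc[m3 ex3 /IHd[m4 ex4 eq4]].
  by exists m4 => //; apply: ExLoop ex3 ex4.
Qed.

(** A control state is the stack of commands still to be run. Leaving or unrolling a star is the
    only choice. *)
Definition sstep (s s' : seq cmd) : bool :=
  match s with
  | [::] => false
  | CAtom _ :: k => s' == k
  | CSeq a b :: k => s' == [:: a, b & k]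
  | CStar a :: k => (s' == k) || (s' == [:: a, CStar a & k])
  end.

Definition head_sem (s : seq cmd) (m m' : store) : Prop :=
  if s is CAtom a :: _ then atom_sem a m m' else m' =1 m.

Fixpoint stack_sem (s : seq cmd) (m : store) : Prop :=
  if s is c :: k then exists2 m', exec c m m' & stack_sem k m' else True.

Lemma stack_sem_ext s m m1 : m1 =1 m -> stack_sem s m -> stack_sem s m1.
Proof.
elim: s m m1 => //= c k IHk m m1 eqm [m' ex].
by have [m1' ex1 eq1] := exec_ext ex eqm => /(IHk _ _ eq1); exists m1'.
Qed.

Lemma sstep_sem s s' m m' :
  sstep s s' -> head_sem s m m' -> stack_sem s' m' -> stack_sem s m.
Proof.
case: s => [//|[a|a b|a] k] /=.
- by move=> /eqP -> am sk; exists m' => //; apply: ExAtom.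
- move=> /eqP -> eqm H.
  have /= [m1 ex1 [m2 ex2 sk]] := stack_sem_ext (fsym eqm) H.
  by exists m2 => //; apply: ExSeq ex1 ex2.
- case/orP=> /eqP -> eqm H.
    by exists m; [apply: ExStop | apply: stack_sem_ext H].
  have /= [m1 ex1 [m2 ex2 sk]] := stack_sem_ext (fsym eqm) H.
  by exists m2 => //; apply: ExLoop ex1 ex2.
Qed.

(** Every step changes the height of the stack by one. That consecutive states differ later keeps
    letters out of the word repeated in a pattern. *)
Lemma sstep_neq s s' : sstep s s' -> s != s'.
Proof.
have neq (k k' : seq cmd) : size k <> size k' -> k != k'.
  by move=> ne; apply/eqP=> e; apply: ne; rewrite e.
case: s => [//|[a|a b|a] k] /=; first by move/eqP->; apply: neq => /=; lia.
  by move/eqP->; apply: neq => /=; lia.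
by case/orP=> /eqP->; apply: neq => /=; lia.
Qed.

Definition srun s m s' m' := exists n (qs : nat -> seq cmd) (ms : nat -> store),
  [/\ qs 0 = s, ms 0 = m, qs n = s', ms n = m' &
      forall t, t < n -> sstep (qs t) (qs t.+1) /\ head_sem (qs t) (ms t) (ms t.+1)].

Lemma srun_step s m s' m' : sstep s s' -> head_sem s m m' -> srun s m s' m'.
Proof.
move=> ss hs; exists 1, (fun t => if t is 0 then s else s').
by exists (fun t => if t is 0 then m else m'); split=> // -[].
Qed.

Lemma srun_trans s1 m1 s m s' m' :
  srun s m s1 m1 -> srun s1 m1 s' m' -> srun s m s' m'.
Proof.
move=> [n [qs [ms [q0 m0 qn mn H]]]] [n' [qs' [ms' [q0' m0' qn' mn' H']]]].
exists (n + n'), (fun t => if t <= n then qs t else qs' (t - n)).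
exists (fun t => if t <= n then ms t else ms' (t - n)).
(* At the seam [t = n] the two runs agree, so either may provide the value there. *)
have ext (U : Type) (f g : nat -> U) t : f n = g 0 ->
    (if t <= n then f t else g (t - n)) = if t < n then f t else g (t - n).
  by move=> e; case: ltngtP => // ->; rewrite subnn.
split=> //.
- by rewrite ext ?qn ?q0' // ifN ?addKn //; lia.
- by rewrite ext ?mn ?m0' // ifN ?addKn //; lia.
- move=> t ltt; rewrite [if t <= n then qs t else _]ext ?qn ?q0' //.
  rewrite [if t <= n then ms t else _]ext ?mn ?m0' //.
  by case: ltnP => [/H //|le]; rewrite subSn //; apply: H'; lia.
Qed.

Lemma exec_srun c m m' : exec c m m' -> forall k, srun (c :: k) m k m'.
Proof.
elim=> {c m m'} [a m m' am|c d m m1 m' _ IHc _ IHd|c m|c m m1 m' _ IHc _ IHd] k.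
- by apply: srun_step => /=.
- apply: (@srun_trans [:: c, d & k] m); first by apply: srun_step => /=.
  exact: srun_trans (IHc _) (IHd _).
- by apply: srun_step => //=; rewrite eqxx.
- apply: (@srun_trans [:: c, CStar c & k] m).
    by apply: srun_step => //=; rewrite eqxx orbT.
  exact: srun_trans (IHc _) (IHd _).
Qed.

(* A history word does not record the registers after the last step; pushing  *)
(* [cskip] below [c] makes that step harmless.                                *)
Lemma exec_history c m : (exists m', exec c m m') <->
  exists n (qs : nat -> seq cmd) (ms : nat -> store),
    [/\ qs 0 = [:: c; cskip], ms 0 =1 m, qs n = [::],
        forall t, t < n -> sstep (qs t) (qs t.+1) &
        forall t, t.+1 < n -> head_sem (qs t) (ms t) (ms t.+1)].
Proof.
split=> [[m' /exec_srun ex]|].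
  have := srun_trans (ex [:: cskip]) (exec_srun (exec_cskip m') [::]).
  case=> n [qs [ms [q0 m0 qn _ H]]]; exists n, qs, ms.
  split=> // [t|t|t ltt]; [by rewrite m0 | by case/H | by case: (H t (ltnW ltt))].
case=> n [qs [ms [q0 m0 qn Hq Hm]]].
(* Until the run ends, [cskip] stays at the bottom of the stack, so the very last step can only
   execute [cskip]. *)
have inv t : t < n -> last cskip (qs t) = cskip.
  elim: t => [_|t IHt ltt]; first by rewrite q0.
  have := Hq _ ltt; have := Hq _ (ltnW ltt); move: (IHt (ltnW ltt)).
  case: (qs t) => [//|[a|a b|a] k] /=; last move=> e /orP[].
  - by move=> e /eqP-> H; case: k e H.
  - by move=> e /eqP-> _; rewrite /= in e *; case: k e.
  - by move=> /eqP-> H; case: k e H.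
  - by move=> /eqP-> _; case: k e.
case: n qn Hq Hm inv => [|n] qn Hq Hm inv; first by rewrite q0 in qn.
have qnE : qs n = [:: cskip].
  have := inv n (ltnSn n); have := Hq n (ltnSn n); rewrite qn.
  case: (qs n) => [//|[a|a b|a] [|d k]] //=.
  by move=> _ ->.
have semn t : t <= n -> stack_sem (qs (n - t)) (ms (n - t)).
  elim: t => [_|t IHt ltt].
    by rewrite subn0 qnE; exists (ms n) => //; apply: exec_cskip.
  have e : n - t = (n - t.+1).+1 by lia.
  have lt1 : (n - t.+1).+1 < n.+1 by lia.
  apply: sstep_sem (Hq _ _) (Hm _ lt1) _; first by lia.
  by rewrite -e; apply: IHt; lia.
have := semn n (leqnn n); rewrite subnn q0 => -[m' ex _].
by have [m1 ex1 _] := exec_ext ex (fsym m0); exists m1.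
Qed.

(** The stacks that may arise between [c :: k] and [k]. They are finitely many because the body of a
    star always lies on that same star. *)
Fixpoint conts (c : cmd) (k : seq cmd) : seq (seq cmd) :=
  (c :: k) :: match c with
              | CAtom _ => [::]
              | CSeq a b => conts a (b :: k) ++ conts b k
              | CStar a => conts a (CStar a :: k)
              end.

Lemma conts_head c k : c :: k \in conts c k.
Proof. by case: c => *; rewrite /= mem_head. Qed.

Lemma conts_step c k s s' :
  s \in conts c k -> sstep s s' -> (s' == k) || (s' \in conts c k).
Proof.
elim: c k => [a|a IHa b IHb|a IHa] k; rewrite [conts _ _]/= !in_cons.
- by rewrite in_nil orbF => /eqP-> /= ->.
- rewrite !mem_cat => /or3P[/eqP->|/IHa H|/IHb H].
  + by move=> /= /eqP->; rewrite conts_head !orbT.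
  + by case/H/orP=> [/eqP->|->]; rewrite ?conts_head !orbT.
  + by case/H/orP=> ->; rewrite ?orbT.
- case/orP=> [/eqP->|/IHa H].
    by move=> /= /orP[]/eqP->; rewrite ?eqxx ?conts_head ?orbT.
  by case/H/orP=> ->; rewrite ?orbT.
Qed.

Definition abound (a : atom) :=
  match a with ASet i j _ _ | ATest i j => maxn i.+1 j.+1 end.

Fixpoint cbound (c : cmd) :=
  match c with
  | CAtom a => abound a
  | CSeq a b => maxn (cbound a) (cbound b)
  | CStar a => cbound a
  end.

Lemma conts_bound K c k s : s \in conts c k -> cbound c <= K ->
  all (fun d => cbound d <= K) k -> all (fun d => cbound d <= K) s.
Proof.
elim: c k => [a|a IHa b IHb|a IHa] k; rewrite [conts _ _]/= !in_cons.
- by rewrite in_nil orbF => /eqP-> /= -> ->.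
- rewrite !mem_cat => H /= cb kb; move: (cb); rewrite geq_max => /andP[ca cb'].
  case/or3P: H => [/eqP->|/IHa|/IHb]; first by rewrite /= cb.
    by apply=> //=; rewrite cb'.
  by apply.
- move=> H /= ca kb; case/orP: H => [/eqP->|/IHa]; first by rewrite /= ca.
  by apply=> //=; rewrite ca.
Qed.

(* [(i, j, c, d)] is the constraint [x' i + c = x j + d] between the register *)
(* contents before and after a step.                                          *)
Definition constr := (nat * nat * bool * bool)%type.

Definition csat (x x' : nat -> nat) (e : constr) :=
  let: (i, j, c, d) := e in x' i + c == x j + d.

Definition keep (ls : seq nat) : seq constr := [seq (l, l, false, false) | l <- ls].

(** A test, too, is put as a relation between new and old contents; since registers are kept, the
    new contents of [i] are the old ones. *)
Definition head_constr K (s : seq cmd) : seq constr :=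
  match s with
  | CAtom (ASet i j c d) :: _ =>
      (i, j, c, d) :: keep [seq l <- iota 0 K | l != i]
  | CAtom (ATest i j) :: _ => (i, j, false, false) :: keep (iota 0 K)
  | _ => keep (iota 0 K)
  end.

Lemma keepP x x' ls :
  reflect {in ls, x' =1 x} (all (csat x x') (keep ls)).
Proof.
rewrite all_map; apply: (iffP allP) => H l /H /=; rewrite !addn0; first by move/eqP.
by move->.
Qed.

Lemma head_semP K s m m' : all (fun d => cbound d <= K) s ->
    (forall l, K <= l -> m l = 0 /\ m' l = 0) ->
  head_sem s m m' <-> all (csat m m') (head_constr K s).
Proof.
move=> sb big.
have keepK : m' =1 m <-> all (csat m m') (keep (iota 0 K)).
  split=> [eqm|/keepP H l]; first by apply/keepP.
  case: (ltnP l K) => [ltl|/big[-> ->] //].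
  by apply: H; rewrite mem_iota.
case: s sb => [|[[i j c d|i j]|a b|a] k] //= /andP[ib _].
- split=> [[-> H]|/andP[/eqP -> /keepP H]].
    by rewrite eqxx; apply/keepP=> l; rewrite mem_filter => /andP[/H].
  split=> // l nl; case: (ltnP l K) => [ltl|/big[-> ->] //].
  by apply: H; rewrite mem_filter nl mem_iota.
- split=> [[eij /[dup] H /keepK ->]|/andP[/eqP e /keepK H]].
    by rewrite H eij eqxx.
  by split=> //; move: e; rewrite H !addn0.
Qed.

Lemma head_constr_bound K s : all (fun d => cbound d <= K) s ->
  all (fun e : constr => (e.1.1.1 < K) && (e.1.1.2 < K)) (head_constr K s).
Proof.
have keepK ls : {subset ls <= iota 0 K} ->
    all (fun e : constr => (e.1.1.1 < K) && (e.1.1.2 < K)) (keep ls).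
  by move=> sub; rewrite all_map; apply/allP=> l /sub /=; rewrite mem_iota => /andP[_ ->].
have keepT : all (fun e : constr => (e.1.1.1 < K) && (e.1.1.2 < K)) (keep (iota 0 K)).
  exact: keepK.
case: s => [|[[i j c d|i j]|a b|a] k] //=.
- rewrite geq_max => /andP[/andP[-> ->] _] /=.
  by apply: keepK => l; rewrite mem_filter => /andP[].
- by rewrite geq_max => /andP[/andP[-> ->] _].
Qed.

(** The interface between programs and words: a finite control whose steps constrain [K] counters.
    As in [exec_history], the last step is unconstrained. *)
Definition machine_run (Q : Type) (T : rel Q) (constrs : Q -> seq constr) K
    (q0 qf : Q) (x0 : nat -> nat) :=
  exists n (qs : nat -> Q) (x : nat -> nat -> nat),
    [/\ qs 0 = q0, qs n = qf, forall t, t < n -> T (qs t) (qs t.+1),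
        forall t, t.+1 < n -> all (csat (x t) (x t.+1)) (constrs (qs t)) &
        forall i, i < K -> x 0 i = x0 i].

Section Program.
Variables (c : cmd) (K : nat).
Hypothesis cK : cbound c <= K.
Hypothesis K0 : 0 < K.

Definition pstates := conts c [:: cskip] ++ [:: [:: cskip]; [::]].
(** Positions in the list form a finite type of states. A stack may have several positions, which is
    harmless. *)
Definition pstate (q : 'I_(size pstates)) : seq cmd := nth [::] pstates q.
Definition pstep : rel 'I_(size pstates) := fun q q' => sstep (pstate q) (pstate q').
Definition pconstr (q : 'I_(size pstates)) := head_constr K (pstate q).

Lemma pstates_step s s' : s \in pstates -> sstep s s' -> s' \in pstates.
Proof.
rewrite /pstates !mem_cat !inE => /or3P[/conts_step H /H /orP[]->|/eqP->|/eqP->] //=.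
- by rewrite orbT.
- by move=> ->; rewrite !orbT.
Qed.

Lemma pstates_bound s : s \in pstates -> all (fun d => cbound d <= K) s.
Proof.
rewrite /pstates !mem_cat !inE => /or3P[/conts_bound|/eqP->|/eqP->] //=.
  by apply=> //=; rewrite K0.
by rewrite K0.
Qed.

Lemma pstate_in q : pstate q \in pstates.
Proof. exact: mem_nth. Qed.

Lemma pstate_surj s : s \in pstates -> exists q, pstate q = s.
Proof.
move=> ins; have lti : index s pstates < size pstates by rewrite index_mem.
by exists (Ordinal lti); rewrite /pstate nth_index.
Qed.

Lemma pstep_neq q q' : pstep q q' -> q != q'.
Proof. by move/sstep_neq; apply: contraNneq => ->. Qed.

Lemma program_run m q0 qf : pstate q0 = [:: c; cskip] -> pstate qf = [::] ->
    (forall l, K <= l -> m l = 0) ->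
  (exists m', exec c m m') <-> machine_run pstep pconstr K q0 qf m.
Proof.
move=> q0E qfE m0; rewrite exec_history; split.
- case=> n [qs [ms [s0 ms0 sn Hs Hm]]].
  have ins t : t <= n -> qs t \in pstates.
    elim: t => [_|t IHt ltt].
      by rewrite s0 -q0E pstate_in.
    by apply: pstates_step (Hs _ ltt); apply: IHt; apply: ltnW.
  have n0 : n != 0 by apply: contra_eqN sn => /eqP->; rewrite s0.
  (* Positions are chosen for the stacks of the run; at both ends they must be the prescribed [q0]
     and [qf], which [index] need not return. *)
  pose qq t := if t == 0 then q0 else if t == n then qf else
    if insub (index (qs t) pstates) is Some q then q else q0.
  have qqE t : t <= n -> pstate (qq t) = qs t.
    rewrite /qq; case: eqP => [-> _|_]; first by rewrite q0E.
    case: eqP => [-> _|_ /ins int]; first by rewrite qfE.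
    rewrite insubT ?index_mem // => lti.
    by rewrite /pstate nth_index.
  (* No command mentions a register from [K] on; these are cut to zero so that [head_semP]
     applies. *)
  exists n, qq, (fun t l => if l < K then ms t l else 0).
  split=> [||t ltt|t ltt|i ltK].
  + by [].
  + by rewrite /qq eqxx (negbTE n0).
  + by rewrite /pstep !qqE //; [apply: Hs | apply: ltnW].
  + rewrite /pconstr qqE; last by lia.
    have bnd := pstates_bound (ins t ltac:(lia)).
    apply/(head_semP bnd); first by move=> l leK; rewrite ltnNge leK.
    have := Hm _ ltt; case: (qs t) bnd => [|[[i j a b|i j]|a b|a] k] //=.
    * by move=> _ H l; rewrite H.
    * rewrite geq_max => /andP[/andP[-> ->] _] [-> H]; split=> // l nl.
      by rewrite H.
    * by rewrite geq_max => /andP[/andP[-> ->] _] [-> H]; split=> // l; rewrite H.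
    * by move=> _ H l; rewrite H.
    * by move=> _ H l; rewrite H.
  + by rewrite /= ltK ms0.
- case=> n [qs [x [e0 en Hs Hc Hx]]].
  exists n, (fun t => pstate (qs t)), (fun t l => if l < K then x t l else 0).
  split=> [|l|||t ltt].
  + by rewrite e0.
  + by case: ltnP => [/Hx //|/m0].
  + by rewrite en.
  + exact: Hs.
  + apply/(head_semP (pstates_bound (pstate_in _))).
      by move=> l leK; rewrite ltnNge leK.
    have := Hc _ ltt; have := head_constr_bound (pstates_bound (pstate_in (qs t))).
    move=> /allP bnd /allP sat; apply/allP=> e ine.
    have := sat e ine; have := bnd e ine; case: e {ine} => [[[i j] a] b] /=.
    by case/andP=> -> ->.
Qed.
End Program.

(** * Error patterns *)

Section Patterns.
Variable Lam : eqType.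
Local Notation word := (seq (option Lam)).

(* [inl l] is the letter [l], [inr None] a word variable common to the whole  *)
(* pattern, [inr (Some c)] any run of at least [c] zeros.                     *)
Definition pitem := (Lam + option nat)%type.
Definition PLet (l : Lam) : pitem := inl l.
Definition PA : pitem := inr None.
Definition PLow c : pitem := inr (Some c).

Definition zeros n : word := nseq n None.

Fixpoint pmatch (a w : word) (p : seq pitem) : Prop :=
  match p with
  | [::] => w = [::]
  | inl l :: p' => exists2 w', w = Some l :: w' & pmatch a w' p'
  | inr None :: p' => exists2 w', w = a ++ w' & pmatch a w' p'
  | inr (Some c) :: p' =>
      exists n w', [/\ c <= n, w = zeros n ++ w' & pmatch a w' p']
  end.

Definition occurs p h := exists P F Q a, h = P ++ F ++ Q /\ pmatch a F p.

(** [None] is the letter zero. A word is a leading run of zeros followed by blocks, each a letter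
    with the number of zeros after it; this form is unique. *)
Fixpoint dec (w : word) : nat * seq (Lam * nat) :=
  match w with
  | [::] => (0, [::])
  | None :: w' => ((dec w').1.+1, (dec w').2)
  | Some l :: w' => (0, (l, (dec w').1) :: (dec w').2)
  end.

Definition enc (bs : seq (Lam * nat)) : word :=
  flatten [seq Some b.1 :: zeros b.2 | b <- bs].

Lemma enc_cat bs1 bs2 : enc (bs1 ++ bs2) = enc bs1 ++ enc bs2.
Proof. by rewrite /enc map_cat flatten_cat. Qed.

Lemma enc_cons b bs : enc (b :: bs) = Some b.1 :: zeros b.2 ++ enc bs.
Proof. by []. Qed.

Lemma decK w : zeros (dec w).1 ++ enc (dec w).2 = w.
Proof. by elim: w => [|[l|] w IHw] //=; rewrite ?enc_cons /= IHw. Qed.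

Lemma dec_zeros n w : dec (zeros n ++ w) = (n + (dec w).1, (dec w).2).
Proof. by elim: n => [|n IHn] /=; [case: (dec w) | rewrite IHn]. Qed.

Lemma dec_enc bs w : (dec w).1 = 0 -> dec (enc bs ++ w) = (0, bs ++ (dec w).2).
Proof.
move=> w0; elim: bs => [|[l n] bs IHbs]; first by rewrite -w0; case: (dec w).
by rewrite enc_cons /= -catA dec_zeros IHbs addn0.
Qed.

Lemma dec_cat w1 l w2 : dec (w1 ++ Some l :: w2) =
  ((dec w1).1, (dec w1).2 ++ (l, (dec w2).1) :: (dec w2).2).
Proof. by elim: w1 => [|[l'|] w1 IHw] //=; rewrite IHw. Qed.

(** Without a bound the run is empty, so it contributes no item. *)
Definition low (o : option nat) : seq pitem := if o is Some c then [:: PLow c] else [::].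
Definition lowb (o : option nat) e := if o is Some c then c <= e else e == 0.

Lemma pmatch_low a w o p : pmatch a w (low o ++ p) <->
  exists e w', [/\ lowb o e, w = zeros e ++ w' & pmatch a w' p].
Proof.
case: o => [c|] //=; split=> [H|[e [w' [/eqP-> -> //]]]].
by exists 0, w.
Qed.

Definition skips (ls : seq Lam) : seq pitem :=
  flatten [seq [:: PLet l; PLow 0] | l <- ls].

Lemma pmatch_skips a w ls p : pmatch a w (skips ls ++ p) <->
  exists bs w', [/\ map fst bs = ls, w = enc bs ++ w' & pmatch a w' p].
Proof.
elim: ls w => [|l ls IHls] w /=.
  by split=> [H|[[|b bs] [w' [] // _ ->] //]]; exists [::], w.
split.
  case=> _ -> [n [w' [_ -> /IHls[bs [w2 [<- -> H]]]]]].
  by exists ((l, n) :: bs), w2; rewrite enc_cons /= -catA.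
case=> -[|[l' n] bs] [w' [] //= [e1 e2] -> H]; subst l' ls.
rewrite -catA; eexists; first by [].
exists n, (enc bs ++ w'); split=> //; apply/IHls; by exists bs, w'.
Qed.

Definition adjacent_pat l l' : seq pitem := [:: PLet l; PLow 0; PLet l'].

Lemma occurs_adjacent l l' h : occurs (adjacent_pat l l') h <->
  exists bs1 v v' bs2, (dec h).2 = bs1 ++ (l, v) :: (l', v') :: bs2.
Proof.
split.
  case=> P [F [W [a [-> [_ -> [n [w' [_ -> [_ -> ->]]]]]]]]].
  rewrite /= -catA cat1s dec_cat dec_zeros /=; do 4 eexists; by [].
case=> bs1 [v [v' [bs2 e]]].
exists (zeros (dec h).1 ++ enc bs1), (Some l :: zeros v ++ [:: Some l']).
exists (zeros v' ++ enc bs2), [::]; split.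
  by rewrite -{1}(decK h) e enc_cat !enc_cons /= -!catA.
eexists; first by [].
by exists v, [:: Some l']; split=> //; exists [::].
Qed.

(** If the repeated word is [n] zeros, the blocks of [l0] and [lr] have lengths [e + n] and
    [n + e'], so that conditions on [e] and [e'] compare the two lengths. *)
Definition compare_pat l0 pre ls lr post l1 : seq pitem :=
  PLet l0 :: low pre ++ PA :: skips ls ++ PLet lr :: PA :: low post ++ [:: PLet l1].

Lemma compare_patP a F l0 pre ls lr post l1 :
  pmatch a F (compare_pat l0 pre ls lr post l1) <->
  exists e e' bs, [/\ lowb pre e, lowb post e', map fst bs = ls &
    F = Some l0 :: zeros e ++ a ++ enc bs ++ Some lr :: a ++ zeros e' ++ [:: Some l1]].
Proof.
split.
  case=> w1 -> /pmatch_low[e [w2 [le -> [w3 ->]]]].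
  case/pmatch_skips=> bs [w4 [<- -> [w5 -> [w6 -> /pmatch_low[e' [w7 [le' -> [w8 -> ->]]]]]]]].
  by exists e, e', bs.
case=> e [e' [bs [le le' <- ->]]]; eexists; first by [].
apply/pmatch_low; exists e; eexists; split=> //; eexists; first by [].
apply/pmatch_skips; exists bs; eexists; split=> //.
eexists; first by []; eexists; first by [].
apply/pmatch_low; exists e'; eexists; split=> //.
by exists [::].
Qed.

Lemma occurs_compareI h l0 pre lr post l1 bs1 bs bs2 e n e' v :
    lowb pre e -> lowb post e' ->
    (dec h).2 = bs1 ++ (l0, e + n) :: bs ++ (lr, n + e') :: (l1, v) :: bs2 ->
  occurs (compare_pat l0 pre (map fst bs) lr post l1) h.
Proof.
move=> le le' E; exists (zeros (dec h).1 ++ enc bs1); eexists.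
exists (zeros v ++ enc bs2), (zeros n); split; last first.
  by apply/compare_patP; exists e, e', bs.
rewrite -{1}(decK h) E enc_cat enc_cons enc_cat !enc_cons /=.
by rewrite /zeros !nseqD -!catA /= -!catA /= -?catA.
Qed.

(** If the repeated word contains a letter, its first letter [mu] follows both the block of [l0] and
    that of [lr]. Otherwise it is a run of zeros. *)
Lemma occurs_compareE h l0 pre ls lr post l1 :
    occurs (compare_pat l0 pre ls lr post l1) h ->
  (exists mu v v' bs1 bs2 bs3 bs4 w w',
     (dec h).2 = bs1 ++ (l0, v) :: (mu, w) :: bs2 /\
     (dec h).2 = bs3 ++ (lr, v') :: (mu, w') :: bs4) \/
  exists e n e' v bs1 bs bs2, [/\ lowb pre e, lowb post e', map fst bs = ls &
    (dec h).2 = bs1 ++ (l0, e + n) :: bs ++ (lr, n + e') :: (l1, v) :: bs2].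
Proof.
case=> P [F [W [a [hE /compare_patP[e [e' [bs [le le' bsE FE]]]]]]]].
rewrite {}FE /= -?catA /= -?catA /= -?catA /= -?catA /= -?catA /= in hE.
set Y := enc bs ++ _ in hE.
case aE: (dec a) => [n [|[mu w] r]].
- right; have {}aE : a = zeros n by rewrite -(decK a) aE /= cats0.
  have YE : dec Y = (0, bs ++ (lr, n + e') :: (l1, (dec W).1) :: (dec W).2).
    by rewrite /Y dec_enc //= aE !dec_zeros /= addn0.
  exists e, n, e', (dec W).1, (dec P).2, bs, (dec W).2; split=> //.
  by rewrite hE dec_cat !dec_zeros aE dec_zeros YE /= addn0.
- left; have {}aE : a = zeros n ++ Some mu :: zeros w ++ enc r.
    by rewrite -(decK a) aE enc_cons.
  have muE X : exists w1 bs0, dec (a ++ X) = (n, (mu, w1) :: bs0).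
    by rewrite aE -catA dec_zeros /= addn0; do 2 eexists.
  have [w1 [bs2 e1]] := muE Y.
  have [w2 [bs4 e2]] := muE (zeros e' ++ Some l1 :: W).
  exists mu, (e + n), n, (dec P).2, bs2.
  exists (dec (P ++ Some l0 :: zeros e ++ a ++ enc bs)).2, bs4, w1, w2; split.
    by rewrite hE dec_cat dec_zeros e1.
  rewrite hE; have -> : P ++ Some l0 :: zeros e ++ a ++ Y =
      (P ++ Some l0 :: zeros e ++ a ++ enc bs) ++ Some lr :: a ++ zeros e' ++ Some l1 :: W.
    by rewrite /Y -!catA /= -!catA.
  by rewrite dec_cat e2.
Qed.

End Patterns.

(** * Histories of runs *)

Section Histories.
Variables (Q : finType) (K : nat) (T : rel Q) (constrs : Q -> seq constr).
Hypothesis T_neq : forall q q', T q q' -> q != q'.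
Hypothesis constrs_bound : forall q,
  all (fun e : constr => (e.1.1.1 < K) && (e.1.1.2 < K)) (constrs q).

Definition letter := (Q * 'I_K.+1)%type.
Definition lett q i : letter := (q, inord i).

Lemma lettE q i : i <= K -> val (lett q i).2 = i.
Proof. by move=> leK; rewrite /= inordK. Qed.

Lemma lett_inj q i q' i' : i <= K -> i' <= K -> lett q i = lett q' i' -> q = q' /\ i = i'.
Proof. by move=> le le' [-> e]; split=> //; rewrite -(inordK le) e inordK. Qed.

Definition allowed (l l' : letter) :=
  if l.2 < K then (l'.1 == l.1) && (val l'.2 == l.2.+1)
  else (val l'.2 == 0) && T l.1 l'.1.

Definition between q j q' i : seq letter :=
  [seq lett q l | l <- iota j.+1 (K - j)] ++ [seq lett q' l | l <- iota 0 i].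

(* The patterns say [x' i + c < x j + d] and [x' i + c > x j + d].            *)
Definition compare_pats q q' (e : constr) : seq (seq (pitem letter)) :=
  let: (i, j, c, d) := e in
  let pat pre post :=
    compare_pat (lett q j) pre (between q j q' i) (lett q' i) post (lett q' i.+1) in
  [:: pat (Some (c.+1 - d)) None; pat None (Some (d.+1 - c))].

Definition bad_pats : seq (seq (pitem letter)) :=
  [seq adjacent_pat x.1 x.2 | x <- enum {: letter * letter} & ~~ allowed x.1 x.2] ++
  flatten [seq flatten [seq compare_pats x.1 x.2 e | e <- constrs x.1]
          | x <- enum {: Q * Q} & T x.1 x.2].

Lemma bad_adjacent l l' : ~~ allowed l l' -> adjacent_pat l l' \in bad_pats.
Proof.
move=> nal; rewrite mem_cat; apply/orP; left.
by apply/mapP; exists (l, l') => //; rewrite mem_filter nal mem_enum.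
Qed.

Lemma bad_compare q q' e p :
  T q q' -> e \in constrs q -> p \in compare_pats q q' e -> p \in bad_pats.
Proof.
move=> Tq ine inp; rewrite mem_cat; apply/orP; right.
apply/flatten_mapP; exists (q, q'); first by rewrite mem_filter Tq mem_enum.
by apply/flatten_mapP; exists e.
Qed.

Lemma bad_patsP p : p \in bad_pats ->
  (exists l l', ~~ allowed l l' /\ p = adjacent_pat l l') \/
  (exists q q' e, [/\ T q q', e \in constrs q & p \in compare_pats q q' e]).
Proof.
rewrite mem_cat => /orP[/mapP[[l l'] /=]|/flatten_mapP[[q q'] /=]].
  by rewrite mem_filter => /andP[nal _] ->; left; exists l, l'.
rewrite mem_filter => /andP[Tq _] /flatten_mapP[e ine inp]; right.
by exists q, q', e.
Qed.

(* Block [K] holds no register: its contents are unconstrained, so that [S]   *)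
(* may start with zeros, and every register block is followed by a letter of  *)
(* the same state.                                                            *)
Definition history q0 qf (x0 : nat -> nat) (S : seq (option letter)) :=
  enc [seq (lett q0 i, x0 i) | i <- iota 0 K] ++
  Some (lett q0 K) :: S ++ [:: Some (lett qf 0)].

Section OfRun.
Variables (n : nat) (qs : nat -> Q) (x : nat -> nat -> nat).
Hypothesis HT : forall t, t < n -> T (qs t) (qs t.+1).
Hypothesis Hc : forall t, t.+1 < n -> all (csat (x t) (x t.+1)) (constrs (qs t)).

(** All blocks of all configurations in one numbering: the quotient by [K.+1] is the time, the
    remainder the register. Block [n * K.+1] is the bare letter of the final state. *)
Let block u : letter * nat :=
  (lett (qs (u %/ K.+1)) (u %% K.+1),
   if u < n * K.+1 then x (u %/ K.+1) (u %% K.+1) else 0).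

Let blockE t i : i <= K ->
  block (t * K.+1 + i) = (lett (qs t) i, if t < n then x t i else 0).
Proof.
move=> leK; rewrite /block divnMDl // modnMDl divn_small ?modn_small // addn0.
have -> : (t * K.+1 + i < n * K.+1) = (t < n) by apply/idP/idP; nia.
by [].
Qed.

Let bs := mkseq block (n * K.+1).+1.

Let bs_nth bs1 b bs2 : bs = bs1 ++ b :: bs2 ->
  size bs1 < (n * K.+1).+1 /\ block (size bs1) = b.
Proof.
move=> E; have lt_u : size bs1 < (n * K.+1).+1.
  have : size bs = (n * K.+1).+1 by rewrite size_mkseq.
  by rewrite E size_cat /=; lia.
by split=> //; rewrite -(nth_mkseq b block lt_u) -/bs E nth_cat ltnn subnn.
Qed.

Let bs_nth2 bs1 b b' bs2 : bs = bs1 ++ [:: b, b' & bs2] ->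
  [/\ size bs1 < n * K.+1, block (size bs1) = b & block (size bs1).+1 = b'].
Proof.
move=> E; have [_ bE] := bs_nth E.
have := @bs_nth (rcons bs1 b) b' bs2; rewrite cat_rcons size_rcons.
by case=> // ltu b'E; split=> //; lia.
Qed.

Let next u : u < n * K.+1 -> allowed (block u).1 (block u.+1).1.
Proof.
move=> ltu; rewrite (divn_eq u K.+1); set t := u %/ _; set i := u %% _.
have leK : i <= K by rewrite -ltnS ltn_mod.
have ltt : t < n by rewrite /t ltn_divLR.
rewrite blockE // /allowed lettE //; case: (ltnP i K) => [ltK|geK].
  by rewrite -addnS blockE // lettE //= !eqxx.
have -> : (t * K.+1 + i).+1 = t.+1 * K.+1 + 0 by lia.
by rewrite blockE // lettE //=; apply: HT.
Qed.

Let next_lett u q j l : u < n * K.+1 -> j < K ->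
  (block u).1 = lett q j -> (block u.+1).1 = l -> l = lett q j.+1.
Proof.
move=> /next + ltj e <-; rewrite e /allowed lettE ?(ltnW ltj) // ltj.
case: (block u.+1).1 => q' i /= /andP[/eqP-> /eqP iE].
by congr (_, _); apply: val_inj; rewrite /= iE inordK.
Qed.

(** A forbidden pair contradicts [next]. In a comparison, a letter inside the repeated word would
    follow both register [j] of [q] and register [i] of [q'] and so belong to two distinct states.
    Hence the repeated word is a run of zeros, and the pattern violates a constraint of the run. *)
Let bs_ok p : p \in bad_pats -> ~ occurs p (enc bs).
Proof.
have decE : (dec (enc bs)).2 = bs by rewrite -[enc bs]cats0 dec_enc //= cats0.
case/bad_patsP=> [[l [l' [nal ->]]]|[q [q' [[[[i j] c] d] [Tq ine inp]]]]].
  case/occurs_adjacent=> bs1 [v [v' [bs2]]]; rewrite decE => /bs_nth2[ltu e e'].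
  by case/negP: nal; have := next ltu; rewrite e e'.
have /andP[/= ltiK ltjK] := allP (constrs_bound q) _ ine.
have [pre [post [pE imp]]] : exists pre post,
    p = compare_pat (lett q j) pre (between q j q' i) (lett q' i) post (lett q' i.+1) /\
    forall e m e', lowb pre e -> lowb post e' -> m + e' + c != e + m + d.
  move: inp; rewrite !inE => /orP[]/eqP->.
    exists (Some (c.+1 - d)), None; split=> // e m e' /= le /eqP->.
    by move: le; case: c {ine}; case: d => /=; lia.
  exists None, (Some (d.+1 - c)); split=> // e m e' /= /eqP-> le.
  by move: le; case: c {ine}; case: d => /=; lia.
rewrite {}pE {inp} => /occurs_compareE; rewrite decE => -[].
  case=> mu [v [v' [bs1 [bs2 [bs3 [bs4 [w [w' [/bs_nth2[ltu e1 e2] /bs_nth2[ltu' e3 e4]]]]]]]]]].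
  have /= m1 := next_lett ltu ltjK (congr1 fst e1) (congr1 fst e2).
  have /= m2 := next_lett ltu' ltiK (congr1 fst e3) (congr1 fst e4).
  rewrite m2 in m1; move: m1.
  by case/(@lett_inj q' i.+1 q j.+1) => // eq _; have := T_neq Tq; rewrite eq eqxx.
case=> e [m [e' [v [bs1 [bs0 [bs2 [le le' bsE E]]]]]]].
have [ltu1 e1] := bs_nth E.
set u := size bs1 in ltu1 e1.
have E2 : bs = (bs1 ++ (lett q j, e + m) :: bs0) ++ 
    [:: (lett q' i, m + e'), (lett q' i.+1, v) & bs2] by rewrite E -catA.
have [ltu2 e2 _] := bs_nth2 E2.
(* The number of skipped letters places the second block: it is register [i] of the next
   configuration. *)
have sz0 : size bs0 = K - j + i.
  by rewrite -(size_map fst) bsE size_cat !size_map !size_iota.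
rewrite size_cat /= sz0 -/u in ltu2 e2.
pose t := u %/ K.+1.
have ujE : u = t * K.+1 + j.
  rewrite /t {1}(divn_eq u K.+1); congr (_ + _).
  case: e1 => _ e1 _; rewrite -(inordK (ltnW ltjK : j < K.+1)) -e1 inordK //.
  exact: ltn_pmod.
have u'E : u + (K - j + i).+1 = t.+1 * K.+1 + i by lia.
rewrite u'E blockE in e2; last exact: ltnW.
rewrite ujE blockE in e1; last exact: ltnW.
(* The pattern ends with a letter after the second block, which is therefore not the final one; so
   the constraints of step [t] are available. *)
have ltt : t.+1 < n by nia.
rewrite (ltnW ltt) in e1; rewrite ltt in e2.
case: e1 => qE xE; case: e2 => q'E xE'.
have := allP (Hc ltt) (i, j, c, d); rewrite qE => /(_ ine) /=.
by rewrite xE xE' (negbTE (imp _ _ _ le le')).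
Qed.

Lemma history_of_run (x0 : nat -> nat) : (forall i, i < K -> x 0 i = x0 i) -> 0 < n ->
  exists S, forall p, p \in bad_pats -> ~ occurs p (history (qs 0) (qs n) x0 S).
Proof.
move=> Hx0 n0.
(* [S] starts with the contents of block [K] of the first configuration and stops just before the
   final letter. *)
exists (zeros _ (x 0 K) ++ enc [seq block u | u <- iota K.+1 (n * K.+1 - K.+1)]).
set h := history _ _ _ _; suff -> : h = enc bs by apply: bs_ok.
have -> : bs = [seq block u | u <- iota 0 K] ++ block K ::
    [seq block u | u <- iota K.+1 (n * K.+1 - K.+1)] ++ [:: block (n * K.+1)].
  have -> : [:: block (n * K.+1)] = [seq block u | u <- iota (K.+1 + (n * K.+1 - K.+1)) 1].
    by rewrite subnKC //; nia.
  rewrite -map_cat -iotaD -map_cons -map_cat.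
  have -> : K :: iota K.+1 (n * K.+1 - K.+1 + 1) = iota (0 + K) (n * K.+1 - K.+1 + 1).+1.
    by [].
  by rewrite -iotaD /bs /mkseq; congr (map _ (iota 0 _)); nia.
rewrite enc_cat enc_cons enc_cat /h /history.
have -> : [seq block u | u <- iota 0 K] = [seq (lett (qs 0) i, x0 i) | i <- iota 0 K].
  apply/eq_in_map=> i; rewrite mem_iota => /andP[_ ltK].
  by have := @blockE 0 i (ltnW ltK); rewrite mul0n add0n n0 Hx0.
have := @blockE 0 K (leqnn K); rewrite mul0n add0n n0 => ->.
have := @blockE n 0 (leq0n K); rewrite addn0 ltnn => ->.
by rewrite /enc /= -!catA.
Qed.

End OfRun.

(** Without forbidden pairs the letters run cyclically through the registers, with a step of [T]
    from each configuration to the next; without comparison patterns the constraints hold. *)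
Lemma run_of_history q0 qf x0 S :
    (forall p, p \in bad_pats -> ~ occurs p (history q0 qf x0 S)) ->
  machine_run T constrs K q0 qf x0.
Proof.
set h := history _ _ _ _ => noocc.
pose b0 : letter * nat := (lett q0 0, 0).
have [v [bs' decE]] : exists v bs', (dec h).2 =
    [seq (lett q0 i, x0 i) | i <- iota 0 K] ++ (lett q0 K, v) :: bs'.
  by rewrite /h /history dec_enc //; do 2 eexists.
have [bs'' decE'] : exists bs'', (dec h).2 = bs'' ++ [:: (lett qf 0, 0)].
  by rewrite /h /history -cat_cons catA dec_cat; eexists.
pose N := size (dec h).2; pose b u := nth b0 (dec h).2 u.
have decb : (dec h).2 = [seq b u | u <- iota 0 N].
  by rewrite /b -/(mkseq _ _) mkseq_nth.
have N0 : K < N by rewrite /N decE size_cat /= size_map size_iota; lia.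
have bK i : i < K -> b i = (lett q0 i, x0 i).
  move=> ltK; rewrite /b decE nth_cat size_map size_iota ltK.
  by rewrite (nth_map 0) ?size_iota // nth_iota.
have b00 : (b 0).1 = lett q0 0.
  have [e|K0] := posnP K; last by rewrite bK.
  by rewrite /b decE e.
have bN : b N.-1 = (lett qf 0, 0).
  by rewrite /b nth_last decE' last_cat.
have split_at u r : u + r < N -> (dec h).2 = [seq b l | l <- iota 0 u] ++
    [seq b l | l <- iota u r] ++ [seq b l | l <- iota (u + r) (N - (u + r))].
  move=> ltN; rewrite -!map_cat -iotaD addnC -{1}[u]add0n.
  by rewrite decb -iotaD; congr (map _ (iota _ _)); lia.
have nextb u : u.+1 < N -> allowed (b u).1 (b u.+1).1.
  move=> ltN; apply/negPn/negP=> /bad_adjacent/noocc; apply; apply/occurs_adjacent.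
  exists [seq b l | l <- iota 0 u], (b u).2, (b u.+1).2.
  exists [seq b l | l <- iota u.+2 (N - u.+2)].
  rewrite -!surjective_pairing (split_at u 1) ?addn1 //=.
  by have -> : N - u.+1 = (N - u.+2).+1 by lia.
pose qs t := (b (t * K.+1)).1.1.
have labE t i : i <= K -> t * K.+1 + i < N -> (b (t * K.+1 + i)).1 = lett (qs t) i.
  have lettP (l : letter) i' : val l.2 = i' -> l = lett l.1 i'.
    by case: l => q k /= <-; rewrite /lett inord_val.
  elim: t i => [|t IHt]; elim=> [_|i IHi leK] ltN.
  - by rewrite /qs mul0n b00.
  - have := @nextb (0 * K.+1 + i); rewrite -addnS => /(_ ltN).
    rewrite IHi //; try lia.
    rewrite /allowed lettE ?(ltnW leK) // leK => /andP[/eqP e1 /eqP /lettP ->].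
    by rewrite e1.
  - have e : t.+1 * K.+1 + 0 = (t * K.+1 + K).+1 by lia.
    have := @nextb (t * K.+1 + K); rewrite -e => /(_ ltN).
    rewrite IHt //; last by lia.
    rewrite /allowed lettE // ltnn => /andP[/eqP /lettP + _].
    by rewrite addn0.
  - have := @nextb (t.+1 * K.+1 + i); rewrite -addnS => /(_ ltN).
    rewrite IHi //; try lia.
    rewrite /allowed lettE ?(ltnW leK) // leK => /andP[/eqP e1 /eqP /lettP ->].
    by rewrite e1.
pose n := N.-1 %/ K.+1.
(* The last letter has register 0, so its index is a multiple of [K.+1]. *)
have [NE qnE] : N.-1 = n * K.+1 /\ qs n = qf.
  have ltm : N.-1 %% K.+1 <= K by rewrite -ltnS ltn_pmod.
  have := labE n (N.-1 %% K.+1) ltm; rewrite -divn_eq bN => /(_ ltac:(lia)) /=.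
  case/(@lett_inj qf 0) => // <- m0; split=> //.
  by rewrite {1}(divn_eq N.-1 K.+1) -m0 addn0.
have TE t : t < n -> T (qs t) (qs t.+1).
  move=> ltt; have := @nextb (t * K.+1 + K).
  have -> : (t * K.+1 + K).+1 = t.+1 * K.+1 + 0 by lia.
  have ltN : t.+1 * K.+1 + 0 < N by nia.
  move=> /(_ ltN); rewrite !labE //; last by lia.
  by rewrite /allowed (lettE (qs t) (leqnn K)) ltnn => /andP[].
exists n, qs, (fun t i => (b (t * K.+1 + i)).2).
split=> // [|t ltt|i ltK].
- by rewrite /qs mul0n b00.
- apply/allP=> -[[[i j] c] d] ine.
  have /andP[/= ltiK ltjK] := allP (constrs_bound (qs t)) _ ine.
  apply/negPn/negP=> ne; have Tq := TE t (ltnW ltt).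
  set v' := (b (t.+1 * K.+1 + i)).2 in ne; set v0 := (b (t * K.+1 + j)).2 in ne.
  have occ pre post e m e' : lowb pre e -> lowb post e' -> v0 = e + m ->
      v' = m + e' -> occurs (compare_pat (lett (qs t) j) pre
        (between (qs t) j (qs t.+1) i) (lett (qs t.+1) i) post (lett (qs t.+1) i.+1)) h.
    move=> le le' E E'; pose u := t * K.+1 + j; pose r := K - j + i.
    have -> : between (qs t) j (qs t.+1) i = map fst [seq b l | l <- iota u.+1 r].
      rewrite /r iotaD !map_cat /between; congr (_ ++ _).
        rewrite -map_comp /u -addnS iotaDl -!map_comp; apply/eq_in_map=> l.
        by rewrite mem_iota => /andP[_ ltl] /=; rewrite labE //; nia.
      have -> : u.+1 + (K - j) = t.+1 * K.+1 + 0 by lia.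
      rewrite iotaDl -!map_comp; apply/eq_in_map=> l.
      by rewrite mem_iota => /andP[_ ltl] /=; rewrite labE //; nia.
    apply: (@occurs_compareI _ _ _ _ _ _ _ [seq b l | l <- iota 0 u] _
      [seq b l | l <- iota (t.+1 * K.+1 + i.+2) (N - (t.+1 * K.+1 + i.+2))]
      e m e' (b (t.+1 * K.+1 + i.+1)).2) => //.
    rewrite -E -E' -(@labE t j) ?(ltnW ltjK) //; last by nia.
    rewrite -(@labE t.+1 i) ?(ltnW ltiK) //; last by nia.
    rewrite -(@labE t.+1 i.+1) //; last by nia.
    rewrite -!surjective_pairing (split_at u r.+3); last by rewrite /u /r; nia.
    congr (_ ++ _).
    have -> : iota u r.+3 = u :: iota u.+1 r ++ iota (t.+1 * K.+1 + i) 2.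
      have -> : t.+1 * K.+1 + i = u.+1 + r by rewrite /u /r; lia.
      by rewrite -iotaD addn2.
    rewrite map_cons map_cat cat_cons -catA /= -addnS.
    by have -> : t.+1 * K.+1 + i.+2 = u + r.+3 by rewrite /u /r; lia.
  have bad p : p \in compare_pats (qs t) (qs t.+1) (i, j, c, d) -> ~ occurs p h.
    by move/(bad_compare Tq ine)/noocc.
  (* The repeated word takes the smaller of the two contents; the excess becomes [e] or [e']. *)
  have [lt|ge] := ltnP (v' + c) (v0 + d).
    apply: (bad _ (mem_head _ _)); apply: (occ _ _ (v0 - v') v' 0) => //=;
    by move: lt; case: c {ne ine bad}; case: d => /=; lia.
  apply: (bad _ (mem_last _ _)); apply: (occ _ _ 0 v0 (v' - v0)) => //=;
  by move: ge ne; case: c {ine bad}; case: d => /=; lia.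
- by rewrite mul0n add0n bK.
Qed.

End Histories.

(** * The sentence *)

Section PatternValues.
Variable Lam : eqType.
Local Notation word := (seq (option Lam)).
Local Notation zeros := (@zeros Lam).

Definition all_zero (w : word) := all (pred1 None) w.

Lemma all_zeroP w : reflect (w = zeros (size w)) (all_zero w).
Proof. exact: all_pred1P. Qed.

Lemma all_zeros n : all_zero (zeros n).
Proof. exact: all_pred1_nseq. Qed.

(** Items are addressed by position. A run of at least [c] zeros is [D i] followed by [c] zeros,
    with [D i] arbitrary; that it consists of zeros is a separate condition, on the product
    [gval]. *)
Fixpoint pval (a : word) (D : nat -> word) i (p : seq (pitem Lam)) : word :=
  match p with
  | [::] => [::]
  | inl l :: p' => Some l :: pval a D i.+1 p'
  | inr None :: p' => a ++ pval a D i.+1 p'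
  | inr (Some c) :: p' => D i ++ zeros c ++ pval a D i.+1 p'
  end.

Fixpoint gval (D : nat -> word) i (p : seq (pitem Lam)) : word :=
  match p with
  | [::] => [::]
  | inr (Some _) :: p' => D i ++ gval D i.+1 p'
  | _ :: p' => gval D i.+1 p'
  end.

Lemma pgval_ext a D D' i p :
    (forall j, i <= j < i + size p -> D j = D' j) ->
  pval a D i p = pval a D' i p /\ gval D i p = gval D' i p.
Proof.
elim: p i => [|x p IHp] i eqD //=.
have [] : pval a D i.+1 p = pval a D' i.+1 p /\ gval D i.+1 p = gval D' i.+1 p.
  by apply: IHp => j Hj; apply: eqD => /=; lia.
have Di : D i = D' i by apply: eqD => /=; lia.
by case: x {eqD} => [l|[c|]] -> ->; rewrite ?Di.
Qed.

Lemma size_gval a D i p : size (gval D i p) <= size (pval a D i p).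
Proof.
elim: p i => [|[l|[c|]] p IHp] i //=; have := IHp i.+1; rewrite ?size_cat; lia.
Qed.

Lemma pval_match a D i p : all_zero (gval D i p) -> pmatch a (pval a D i p) p.
Proof.
elim: p i => [|[l|[c|]] p IHp] i //=.
- by move/IHp; exists (pval a D i.+1 p).
- rewrite /all_zero all_cat => /andP[/all_zeroP Di /IHp H].
  exists (size (D i) + c), (pval a D i.+1 p); split=> //; first exact: leq_addl.
  by rewrite {1}Di catA /zeros nseqD.
- by move/IHp; exists (pval a D i.+1 p).
Qed.

Lemma match_pval a w i p : pmatch a w p ->
  exists D, w = pval a D i p /\ all_zero (gval D i p).
Proof.
elim: p i w => [|[l|[c|]] p IHp] i w /=.
- by move=> ->; exists (fun=> [::]).
- by case=> w' -> /(IHp i.+1)[D [-> H]]; exists D.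
- case=> n [w' [lec -> /(IHp i.+1)[D [-> H]]]].
  pose D' j := if j == i then zeros (n - c) else D j.
  have [] := @pgval_ext a D D' i.+1 p.
    by move=> j /andP[ltj _]; rewrite /D' gtn_eqF.
  move=> e1 e2; exists D'; rewrite -e1 -e2 /D' eqxx; split.
    by rewrite catA /zeros -nseqD subnK.
  by rewrite /all_zero all_cat [all _ (zeros _)]all_zeros.
- by case=> w' -> /(IHp i.+1)[D [-> H]]; exists D.
Qed.

End PatternValues.

Section BigTerms.
Variables (Sigma : finType) (V : eqType).

Definition bigcat (ts : seq (sterm Sigma V)) := foldr (@SCat _ _) (SConst V [::]) ts.
Definition bigor (ps : seq (wform Sigma V)) (e : wform Sigma V) :=
  foldr (@WOr _ _) e ps.

Lemma bigcat_val h ts : sterm_val h (bigcat ts) = flatten (map (sterm_val h) ts).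
Proof. by elim: ts => //= t ts ->. Qed.

Lemma bigcat_occ x ts : sterm_occ x (bigcat ts) = \sum_(t <- ts) sterm_occ x t.
Proof. by elim: ts => [|t ts IH] /=; rewrite ?big_nil // big_cons IH. Qed.

End BigTerms.

(** Evaluates a concatenation of variables all of which but one are empty. *)
Lemma flatten_delta (I : finType) (T : Type) (i0 : I) (s : seq T) :
  flatten [seq if i == i0 then s else [::] | i <- enum I] = s.
Proof.
have : count_mem i0 (enum I) = 1 by rewrite count_uniq_mem ?enum_uniq // mem_enum.
elim: (enum I) => //= i r IHr; case: eqP => [_ [r0]|_ /IHr //].
have {r0} : i0 \notin r by rewrite -has_pred1 has_count -[count _ _]add0n r0.
elim: r {IHr} => [|j r IHr] /=; first by rewrite cats0.
by rewrite inE negb_or eq_sym => /andP[/negbTE-> /IHr].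
Qed.

Section Sentence.
Variables (Lam : finType) (pats : seq (seq (pitem Lam))).
Hypothesis pats_PA : {in pats, forall p, count_mem (PA Lam) p <= 2}.
Variables (r : nat) (wi : 'I_r -> seq (option Lam)) (wm we : seq (option Lam)).

Local Notation N := (size pats).
Definition max_size := \max_(p <- pats) size p.
Local Notation M := max_size.
Local Notation word := (seq (option Lam)).

(** The history with its dependence on the input isolated in [r] runs of zeros. *)
Definition whole (d : 'I_r -> nat) (S : word) : word :=
  flatten [seq wi i ++ zeros Lam (d i) | i <- enum 'I_r] ++ wm ++ S ++ we.

(** [None] is the word [S]. Each pattern has its own [Z], used once in [nonzero_form] and once in
    [match_form]. *)
Definition uvar := option 'I_N.
(** The Boolean pairs code [vF], [vA], [vE] and [vE']. The last two serve in both [nonzero_form] and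
    [match_form], which lie in different disjuncts. *)
Definition pvar := ((bool * bool) + (Lam + 'I_M.+1))%type.
Definition evar := ('I_r + (bool + 'I_N * pvar))%type.
Definition var := (uvar + evar)%type.

Definition vS : var := inl None.
Definition vZ p : var := inl (Some p).
Definition vT i : var := inr (inl i).
Definition vPre : var := inr (inr (inl true)).
Definition vPost : var := inr (inr (inl false)).
Definition vF p : var := inr (inr (inr (p, inl (true, true)))).
Definition vA p : var := inr (inr (inr (p, inl (true, false)))).
Definition vE p : var := inr (inr (inr (p, inl (false, true)))).
Definition vE' p : var := inr (inr (inr (p, inl (false, false)))).
Definition vB p l : var := inr (inr (inr (p, inr (inl l)))).
Definition vD p j : var := inr (inr (inr (p, inr (inr (inord j))))).

Local Notation term := (sterm (option Lam) var).
Local Notation form := (wform (option Lam) var).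
Local Notation V := (@SVar (option Lam) var).
Local Notation W := (@SConst (option Lam) var).

Fixpoint pterm (p : 'I_N) i (q : seq (pitem Lam)) : seq term :=
  match q with
  | [::] => [::]
  | inl l :: q' => W [:: Some l] :: pterm p i.+1 q'
  | inr None :: q' => V (vA p) :: pterm p i.+1 q'
  | inr (Some c) :: q' => [:: V (vD p i), W (zeros Lam c) & pterm p i.+1 q']
  end.

Fixpoint gterm (p : 'I_N) i (q : seq (pitem Lam)) : seq term :=
  match q with
  | [::] => [::]
  | inr (Some _) :: q' => V (vD p i) :: gterm p i.+1 q'
  | _ :: q' => gterm p i.+1 q'
  end.

Definition pat (p : 'I_N) := nth [::] pats p.
Definition wfalse : form := WEq (W [:: None]) (W [::]).

(** Says that [Z] contains a letter. A separate equation for each letter would use [Z] too often;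
    instead [Z] is decomposed once, with one variable per letter, and one of these variables must
    equal its letter. *)
Definition nonzero_form p : form :=
  WAnd (WEq (V (vZ p))
            (bigcat (V (vE p) :: [seq V (vB p l) | l <- enum Lam] ++ [:: V (vE' p)])))
       (bigor [seq WEq (V (vB p l)) (W [:: Some l]) | l <- enum Lam] wfalse).

(* The last equation says that the product of the [vD p j] and [vZ p] are     *)
(* prefix-comparable: if [vZ p] is a long run of zeros, all [vD p j] are      *)
(* runs of zeros.                                                             *)
Definition match_form p : form :=
  WAnd (WEq (V (vF p)) (bigcat (pterm p 0 (pat p))))
       (WEq (bigcat (gterm p 0 (pat p) ++ [:: V (vE p)])) (SCat (V (vZ p)) (V (vE' p)))).

Definition whole_form : form :=
  WEq (bigcat (flatten [seq [:: W (wi i); V (vT i)] | i <- enum 'I_r] ++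
               [:: W wm; V vS; W we]))
      (bigcat (V vPre :: [seq V (vF p) | p <- enum 'I_N] ++ [:: V vPost])).

Definition pats_form : form :=
  WOr (bigor [seq nonzero_form p | p <- enum 'I_N] wfalse)
      (WAnd whole_form (bigor [seq match_form p | p <- enum 'I_N] wfalse)).

Definition val_of (X : uvar -> word) (Y : evar -> word) (v : var) : word :=
  match v with inl i => X i | inr j => Y j end.

Lemma bigorP h (I : finType) (f : I -> form) :
  wform_holds h (bigor [seq f i | i <- enum I] wfalse) <-> exists i, wform_holds h (f i).
Proof.
split=> [|[i]].
  elim: (enum I) => //= i s IHs [|/IHs //]; by exists i.
have : i \in enum I by rewrite mem_enum.
elim: (enum I) => //= j s IHs; rewrite inE => /predU1P[->|/IHs H /H]; first by left.
by right.
Qed.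

Lemma pterm_val h p i q : flatten (map (sterm_val h) (pterm p i q)) =
  pval (h (vA p)) (fun j => h (vD p j)) i q.
Proof. by elim: q i => [|[l|[c|]] q IHq] i //=; rewrite IHq. Qed.

Lemma gterm_val h p i q : flatten (map (sterm_val h) (gterm p i q)) =
  gval (fun j => h (vD p j)) i q.
Proof. by elim: q i => [|[l|[c|]] q IHq] i //=; rewrite IHq. Qed.

Lemma whole_val h d : (forall i, h (vT i) = zeros Lam (d i)) ->
  sterm_val h (bigcat (flatten [seq [:: W (wi i); V (vT i)] | i <- enum 'I_r] ++
               [:: W wm; V vS; W we])) = whole d (h vS).
Proof.
move=> hT; rewrite bigcat_val map_cat flatten_cat /= cats0; congr (_ ++ _).
by elim: (enum _) => //= i s ->; rewrite hT catA.
Qed.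

(** Taking every [Z] to be a run of zeros as long as the whole word refutes the first alternative.
    In the second, the product of the [vD] is no longer than the factor, hence than [Z]; being
    prefix-comparable with [Z], it consists of zeros. *)
Lemma pats_form_sound d S :
    (forall X, exists Y, (forall i, Y (inl i) = zeros Lam (d i)) /\
                         wform_holds (val_of X Y) pats_form) ->
  exists2 p, p \in pats & occurs p (whole d S).
Proof.
set n := size (whole d S).
move=> /(_ (fun v => if v is Some _ then zeros Lam n else S))[Y [YT]].
set h := val_of _ _ => -[/bigorP[p [/= Zp /bigorP[l /= Bl]]]|[/= hE]].
  move: Zp; rewrite bigcat_val /= map_cat flatten_cat -map_comp => E.
  suff : Some l \in zeros Lam n by rewrite mem_nseq andbF.
  rewrite E mem_cat; apply/orP; right; rewrite mem_cat; apply/orP; left.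
  apply/flattenP; exists [:: Some l]; last exact: mem_head.
  by apply/mapP; exists l; rewrite ?mem_enum /=.
case/bigorP=> p [/= Fp Gp]; exists (pat p); first exact: mem_nth.
rewrite (@whole_val h d) // bigcat_val /= map_cat flatten_cat /= cats0 -map_comp in hE.
rewrite bigcat_val pterm_val in Fp.
rewrite bigcat_val map_cat flatten_cat gterm_val /= cats0 in Gp.
have [s1 [s2 enumE]] : exists s1 s2, enum 'I_N = s1 ++ p :: s2.
  have : p \in enum 'I_N by rewrite mem_enum.
  by case/splitPr=> s1 s2; exists s1, s2.
rewrite enumE map_cat flatten_cat /= in hE.
set G := gval _ _ _ in Gp.
have leG : size G <= n.
  apply: (@leq_trans (size (Y (inr (inr (p, inl (true, true))))))).
    by rewrite Fp; apply: size_gval.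
  rewrite /n hE !size_cat; apply: leq_trans (leq_addl _ _).
  by apply: leq_trans (leq_addr _ _); apply: leq_trans (leq_addl _ _); apply: leq_addr.
rewrite Fp in hE; do 4 eexists; split; first by rewrite hE -!catA catA; reflexivity.
apply: pval_match; rewrite -[gval _ _ _]/G.
have := congr1 (take (size G)) Gp; rewrite take_size_cat // => ->.
rewrite takel_cat ?size_nseq //.
by apply/allP=> x /mem_take; rewrite mem_nseq => /andP[_].
Qed.

(** A letter in some [Z] makes [nonzero_form] true. If all are runs of zeros, one occurrence of a
    pattern is used and all other factors are left empty. *)
Lemma pats_form_complete d :
    (forall S, exists2 p, p \in pats & occurs p (whole d S)) ->
  forall X, exists Y, (forall i, Y (inl i) = zeros Lam (d i)) /\
                      wform_holds (val_of X Y) pats_form.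
Proof.
move=> Hocc X.
have [/existsP[p nzp]|/existsPn allz] :=
    boolP [exists p : 'I_N, ~~ all_zero (X (Some p))].
  have [l [w1 [w2 Zp]]] : exists l w1 w2, X (Some p) = w1 ++ Some l :: w2.
    move: nzp; rewrite -has_predC => /hasP[[l|] // inl _].
    by case/splitPr: inl => w1 w2; exists l, w1, w2.
  pose Y (v : evar) : word := match v with
    | inl i => zeros Lam (d i)
    | inr (inr (_, inl (false, true))) => w1
    | inr (inr (_, inl (false, false))) => w2
    | inr (inr (_, inr (inl l'))) => if l' == l then [:: Some l] else [::]
    | _ => [::] end.
  exists Y; split=> //; left; apply/bigorP; exists p; split.
    rewrite /= bigcat_val /= map_cat flatten_cat /= cats0 -map_comp.
    by rewrite (flatten_delta l [:: Some l]) Zp.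
  by apply/bigorP; exists l; rewrite /= eqxx.
have [q inq [w1 [F [w2 [a [wE mF]]]]]] := Hocc (X None).
have ltp : index q pats < N by rewrite index_mem.
pose p0 := Ordinal ltp; have pq : pat p0 = q by rewrite /pat nth_index.
have [D [FE Gz]] := match_pval 0 mF.
set G := gval D 0 q in Gz; pose z p := size (X (Some p)).
(* The truncated differences pad [G] and [Z] to a common length, which makes the two sides of the
   comparison the same run of zeros. *)
pose Y (v : evar) : word := match v with
    | inl i => zeros Lam (d i)
    | inr (inl b) => if b then w1 else w2
    | inr (inr (p, inl (true, true))) => if p == p0 then F else [::]
    | inr (inr (_, inl (true, false))) => a
    | inr (inr (p, inl (false, true))) => zeros Lam (z p - size G)
    | inr (inr (p, inl (false, false))) => zeros Lam (size G - z p)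
    | inr (inr (_, inr (inl _))) => [::]
    | inr (inr (_, inr (inr j))) => D j end.
have [pE gE] : pval a D 0 q = pval a (fun j => D (@inord M j)) 0 q /\
               gval D 0 q = gval (fun j => D (@inord M j)) 0 q.
  apply: pgval_ext => j /= ltj; rewrite inordK // ltnS.
  apply: leq_trans (ltnW ltj) _.
  exact: (@leq_bigmax_seq _ _ xpredT (fun p : seq (pitem Lam) => size p) q inq).
exists Y; split=> //; right; split.
  rewrite /whole_form /wform_holds (@whole_val _ d) // [val_of _ _ vS]/= wE.
  rewrite bigcat_val /= map_cat flatten_cat /= cats0 -map_comp.
  by rewrite (flatten_delta p0 F).
apply/bigorP; exists p0; rewrite /match_form pq; split.
  by rewrite /= eqxx bigcat_val pterm_val FE pE.
rewrite /= bigcat_val map_cat flatten_cat gterm_val /= cats0.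
rewrite -/(gval (fun j => D (@inord M j)) 0 q) -gE -/G.
have /all_zeroP -> := negbNE (allz p0).
have /all_zeroP -> := Gz.
by rewrite -/(z p0) size_nseq /zeros -!nseqD; congr nseq; lia.
Qed.

(** * Counting occurrences *)

Lemma bigor_occ x (I : finType) (f : I -> form) :
  wform_occ x (bigor [seq f i | i <- enum I] wfalse) = \sum_i wform_occ x (f i).
Proof.
rewrite -big_enum /=; elim: (enum I) => [|i s IHs] /=; first by rewrite big_nil.
by rewrite big_cons IHs.
Qed.

Lemma bigcat_var_occ x (I : finType) (f : I -> var) :
  \sum_(t <- [seq V (f i) | i <- enum I]) sterm_occ x t = \sum_i (f i == x).
Proof. by rewrite big_map big_enum. Qed.

Lemma sum_delta (I : finType) (i0 : I) c (F : I -> nat) :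
  (forall i, F i <= (i == i0) * c) -> \sum_i F i <= c.
Proof.
move=> leF; apply: (@leq_trans (\sum_i (i == i0) * c)); first exact: leq_sum.
rewrite (bigD1 i0) //= eqxx mul1n big1 ?addn0 // => i /negbTE->.
by rewrite mul0n.
Qed.

Definition vpat (p : 'I_N) (v : pvar) : var := inr (inr (inr (p, v))).

Lemma vpat_eq p v p' v' : (vpat p v == vpat p' v') = (p == p') && (v == v').
Proof. by []. Qed.

Lemma pgterm_occ x p i q : vA p != x -> (forall j, vD p j != x) ->
  \sum_(t <- pterm p i q) sterm_occ x t = 0 /\
  \sum_(t <- gterm p i q) sterm_occ x t = 0.
Proof.
move=> nA nD; elim: q i => [|[l|[c|]] q IHq] i /=; rewrite ?big_nil ?big_cons //=.
- by case: (IHq i.+1) => -> ->.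
- by case: (IHq i.+1) => -> ->; rewrite (negbTE (nD _)).
- by case: (IHq i.+1) => -> ->; rewrite (negbTE nA).
Qed.

Lemma pgterm_occ_inl p i q b1 b2 :
  \sum_(t <- pterm p i q) sterm_occ (vpat p (inl (b1, b2))) t =
    (b1 && ~~ b2) * count_mem (PA Lam) q /\
  \sum_(t <- gterm p i q) sterm_occ (vpat p (inl (b1, b2))) t = 0.
Proof.
elim: q i => [|[l|[c|]] q IHq] i /=; rewrite ?big_nil ?big_cons ?muln0 //=.
- by case: (IHq i.+1) => -> ->.
- by case: (IHq i.+1) => -> ->; rewrite /vD vpat_eq andbF.
- case: (IHq i.+1) => -> ->; rewrite /vA vpat_eq eqxx.
  by split=> //; case: b1 {IHq}; case: b2 => /=; rewrite ?mul1n.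
Qed.

Lemma pgterm_occ_inr p i q (j : 'I_M.+1) : i + size q <= M.+1 ->
  \sum_(t <- pterm p i q) sterm_occ (vpat p (inr (inr j))) t <= (i <= j) /\
  \sum_(t <- gterm p i q) sterm_occ (vpat p (inr (inr j))) t <= (i <= j).
Proof.
elim: q i => [|x q IHq] i /=; first by rewrite !big_nil.
move=> leM; have [] := IHq i.+1 ltac:(lia).
have le1 : (i < j) <= (i <= j) by case: ltngtP.
case: x => [l|[c|]] /= H1 H2; rewrite ?big_cons /=.
- by split; apply: leq_trans le1.
- rewrite /vD vpat_eq eqxx /=.
  have -> : (inr (inr (inord i)) == inr (inr j) :> pvar) = (i == j).
    by rewrite -[LHS]/(inord i == j) -val_eqE /= inordK //; lia.
  by move: H1 H2; case: ltngtP => _ H1 H2; split; lia.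
- by rewrite /vA vpat_eq andbF; split; apply: leq_trans le1.
Qed.

Lemma nonzero_occ x p :
  wform_occ x (nonzero_form p) = (vZ p == x) + ((vE p == x) + (\sum_l (vB p l == x) +
    (vE' p == x))) + \sum_l (vB p l == x).
Proof.
rewrite /= bigcat_occ big_cat /= bigcat_var_occ big_seq1 /= bigor_occ addnA.
by congr (_ + _); apply: eq_bigr => l _ /=; rewrite addn0.
Qed.

Lemma match_occ x p : wform_occ x (match_form p) =
  (vF p == x) + \sum_(t <- pterm p 0 (pat p)) sterm_occ x t +
  (\sum_(t <- gterm p 0 (pat p)) sterm_occ x t + (vE p == x) +
   ((vZ p == x) + (vE' p == x))).
Proof. by rewrite /= !bigcat_occ big_cat big_seq1. Qed.

Lemma whole_occ x : wform_occ x whole_form =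
  \sum_i (vT i == x) + (vS == x) +
  ((vPre == x) + (\sum_p (vF p == x) + (vPost == x))).
Proof.
rewrite /= bigcat_occ big_cat /= bigcat_occ big_cat /= bigcat_var_occ.
rewrite !big_cons !big_nil /= !addn0 add0n; congr (_ + _ + _).
by rewrite big_flatten /= big_map big_enum; apply: eq_bigr => i _;
  rewrite !big_cons big_nil /= addn0.
Qed.

Lemma pats_occ x : wform_occ x pats_form =
  \sum_p wform_occ x (nonzero_form p) + (wform_occ x whole_form +
  \sum_p wform_occ x (match_form p)).
Proof. by rewrite -!bigor_occ. Qed.

(** A variable of [p0] can occur only in [nonzero_form p0], [whole_form] and [match_form p0]. The
    two occurrences are shared out as 0, 1, 1 for [vF]; 0, 0, 2 for [vA] and [vD]; 1, 0, 1 for [vE]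
    and [vE']; 2, 0, 0 for [vB]. *)
Lemma vpat_occ p0 v : wform_occ (vpat p0 v) pats_form <= 2.
Proof.
have bound n1 n2 n3 : n1 + (n2 + n3) <= 2 ->
    (forall p, wform_occ (vpat p0 v) (nonzero_form p) <= (p == p0) * n1) ->
    (forall p, (vF p == vpat p0 v) <= (p == p0) * n2) ->
    (forall p, wform_occ (vpat p0 v) (match_form p) <= (p == p0) * n3) ->
  wform_occ (vpat p0 v) pats_form <= 2.
  move=> le2 H1 H2 H3; rewrite pats_occ; apply: leq_trans le2.
  apply: leq_add; first exact: sum_delta H1.
  apply: leq_add; last exact: sum_delta H3.
  rewrite whole_occ big1 ?add0n ?addn0 //.
  exact: sum_delta H2.
have off p : p != p0 -> wform_occ (vpat p0 v) (nonzero_form p) = 0 /\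
     wform_occ (vpat p0 v) (match_form p) = 0.
  move=> np; have nv v' : (vpat p v' == vpat p0 v) = false.
    by rewrite vpat_eq (negbTE np).
  have sB : \sum_l (vB p l == vpat p0 v) = 0 by apply: big1 => l _; rewrite nv.
  rewrite nonzero_occ match_occ !nv sB.
  by have [||-> ->] := @pgterm_occ (vpat p0 v) p 0 (pat p); rewrite // => *; rewrite nv.
have red n (f : 'I_N -> form) : (forall p, p != p0 -> wform_occ (vpat p0 v) (f p) = 0) ->
    wform_occ (vpat p0 v) (f p0) <= n ->
    forall p, wform_occ (vpat p0 v) (f p) <= (p == p0) * n.
  move=> H0 Hn p; case: eqP => [->|/eqP/H0->] //; by rewrite mul1n.
have redn n1 n2 n3 : n1 + (n2 + n3) <= 2 ->
    wform_occ (vpat p0 v) (nonzero_form p0) <= n1 ->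
    (vF p0 == vpat p0 v) <= n2 ->
    wform_occ (vpat p0 v) (match_form p0) <= n3 ->
  wform_occ (vpat p0 v) pats_form <= 2.
  move=> le2 H1 H2 H3; apply: (bound n1 n2 n3) => //.
  - by apply: red H1 => p /off[].
  - move=> p; case: (p =P p0) => [-> | /eqP np]; first by rewrite mul1n.
    by rewrite vpat_eq (negbTE np).
  - by apply: red H3 => p /off[].
have inp : pat p0 \in pats by exact: mem_nth.
have eqv v' : (vpat p0 v' == vpat p0 v) = (v' == v) by rewrite vpat_eq eqxx.
move: redn; rewrite nonzero_occ match_occ !eqv.
case: v {bound off red} eqv => [[b1 b2]|[l|j]] eqv.
- have [-> ->] := pgterm_occ_inl p0 0 (pat p0) b1 b2.
  have -> : \sum_l (vB p0 l == vpat p0 (inl (b1, b2))) = 0.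
    by apply: big1 => l _; rewrite eqv.
  have := pats_PA inp => leA.
  case: b1 eqv; case: b2 => eqv redn.
  + exact: (redn 0 1 1).
  + by apply: (redn 0 0 2) => //=; rewrite !addn0 add0n mul1n.
  + exact: (redn 1 0 1).
  + exact: (redn 1 0 1).
- have [||-> ->] := @pgterm_occ (vpat p0 (inr (inl l))) p0 0 (pat p0); rewrite ?eqv //.
    by move=> j; rewrite eqv.
  have sB : \sum_l0 (vB p0 l0 == vpat p0 (inr (inl l))) <= 1.
    apply: (@sum_delta _ l) => l0; by rewrite eqv muln1.
  move=> redn; apply: (redn 2 0 0) => //=; lia.
- have -> : \sum_l (vB p0 l == vpat p0 (inr (inr j))) = 0.
    by apply: big1 => l _; rewrite eqv.
  move=> redn.
  have [|H1 H2] := @pgterm_occ_inr p0 0 (pat p0) j.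
    rewrite add0n ltnW // ltnS.
    exact: (@leq_bigmax_seq _ _ xpredT (fun p : seq (pitem Lam) => size p) _ inp).
  apply: (redn 0 0 2) => //=; lia.
Qed.

(** An input variable occurs only once here, which leaves its second occurrence to the equation that
    fixes the input. *)
Lemma pats_form_occ x :
  wform_occ x pats_form <= (if x is inr (inl _) then 1 else 2).
Proof.
have other (y : var) : (forall p v, (vpat p v == y) = false) ->
    wform_occ y pats_form = \sum_p (vZ p == y) +
      (\sum_i (vT i == y) + (vS == y) + ((vPre == y) + (vPost == y)) +
       \sum_p (vZ p == y)).
  move=> ny; rewrite pats_occ whole_occ [\sum_p (vF p == y)]big1 => [|p _]; last by rewrite ny.
  congr (_ + (_ + (_ + _) + _)).
    apply: eq_bigr => p _; rewrite nonzero_occ !ny [\sum_l _]big1 ?addn0 // => l _.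
    by rewrite ny.
  apply: eq_bigr => p _; rewrite match_occ !ny.
  have [||-> ->] := @pgterm_occ y p 0 (pat p); rewrite ?ny ?addn0 // => j.
  by rewrite ny.
case: x => [[p0|]|[i0|[b|[p v]]]]; last exact: vpat_occ.
- rewrite other // [\sum_i (vT i == _)]big1 //= add0n.
  apply: (@leq_add _ _ 1 1);
  by apply: (@sum_delta _ p0) => p; rewrite muln1.
- by rewrite other // !big1.
- rewrite other // [\sum_p _]big1 // !addn0 add0n.
  by apply: (@sum_delta _ i0) => i; rewrite muln1.
- by rewrite other // !big1 //; case: b.
Qed.

End Sentence.

(** * Codes and the diagonal argument *)

Section Rename.
Variables (S1 S2 : finType) (V1 V2 : eqType) (f : S1 -> S2) (g : V1 -> V2).
Hypotheses (f_inj : injective f) (g_inj : injective g).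

Fixpoint sterm_map (t : sterm S1 V1) : sterm S2 V2 :=
  match t with
  | SVar x => SVar _ (g x)
  | SConst w => SConst _ (map f w)
  | SCat t1 t2 => SCat (sterm_map t1) (sterm_map t2)
  end.

Fixpoint wform_map (p : wform S1 V1) : wform S2 V2 :=
  match p with
  | WEq t1 t2 => WEq (sterm_map t1) (sterm_map t2)
  | WAnd p q => WAnd (wform_map p) (wform_map q)
  | WOr p q => WOr (wform_map p) (wform_map q)
  end.

Lemma wform_map_occ x p : wform_occ (g x) (wform_map p) = wform_occ x p.
Proof.
have occ t : sterm_occ (g x) (sterm_map t) = sterm_occ x t.
  by elim: t => //= [y|t1 -> t2 ->] //; rewrite (inj_eq g_inj).
by elim: p => //= [t1 t2|p -> q ->|p -> q ->] //; rewrite !occ.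
Qed.

Lemma wform_map_holds h1 h2 p : (forall x, h2 (g x) = map f (h1 x)) ->
  wform_holds h2 (wform_map p) <-> wform_holds h1 p.
Proof.
move=> eqh; have val t : sterm_val h2 (sterm_map t) = map f (sterm_val h1 t).
  by elim: t => //= t1 -> t2 ->; rewrite map_cat.
elim: p => [t1 t2|p IHp q IHq|p IHp q IHq] /=; last 2 first.
- by rewrite IHp IHq.
- by rewrite IHp IHq.
by rewrite !val; split=> [/(inj_map f_inj)|->].
Qed.

End Rename.

Lemma enum_ord4 : enum 'I_4 = [seq inord i | i <- iota 0 4].
Proof.
apply: (inj_map val_inj); rewrite val_enum_ord -map_comp; apply/esym/map_id_in => i.
by rewrite mem_iota => /andP[_ lti] /=; rewrite inordK.
Qed.

(** The input enters only through these equations, so the code of the remaining matrix is a mere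
    parameter when the code of the sentence is computed. *)
Definition input_eq n k m (i : 'I_4) d : wform 'I_n.+1 ('I_k + 'I_(4 + m))%type :=
  WEq (SVar _ (inr (lshift m i))) (SConst _ (nseq d ord0)).

Definition input_sentence n k m (p : wform 'I_n.+1 ('I_k + 'I_(4 + m))%type)
    (d : 4.-tuple nat) : ae_sentence :=
  AESentence (foldr (fun i => WAnd (input_eq n k m i (tnth d i))) p (enum 'I_4)).

Definition code_input_eq i d := cpair 0 (cpair (cpair 1 i) (cpair 2 (code_seq (nseq d 0)))).

(** The diagonal: each number serves both as a component of the code of a sentence and as an input
    in one of its equations. *)
Definition code_input (v : 4.-tuple nat) : nat :=
  cpair (tnth v (inord 0)) (cpair (tnth v (inord 1)) (cpair (tnth v (inord 2))
    (foldr (fun i c => cpair 1 (cpair (code_input_eq i (tnth v (inord i))) c))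
       (tnth v (inord 3)) (iota 0 4)))).

Definition description n k m (p : wform 'I_n.+1 ('I_k + 'I_(4 + m))%type) :=
  [tuple n.+1; k; 4 + m; code_wform p].

Lemma code_inputE n k m (p : wform 'I_n.+1 ('I_k + 'I_(4 + m))%type) :
  code_input (description p) = code_ae (input_sentence p (description p)).
Proof.
set v := description p; rewrite /code_input /code_ae /input_sentence.
cbn [ae_alphabet ae_univ ae_exist ae_matrix].
rewrite enum_ord4.
have eqc i : i < 4 -> code_wform (input_eq n k m (inord i) (tnth v (inord i))) =
    code_input_eq i (tnth v (inord i)).
  by move=> lti; rewrite /= inordK // map_nseq.
have tE i : i < 4 -> tnth v (inord i) = nth 0 v i.
  by move=> lti; rewrite (tnth_nth 0) inordK.
rewrite !tE //; congr (cpair _ (cpair _ (cpair _ _))).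
by rewrite /foldr /map /iota; cbn [code_wform]; rewrite !eqc.
Qed.

Lemma mcomputable_code_input : mcomputable code_input.
Proof.
have Hp i : mcomputable (fun v : 4.-tuple nat => tnth v i) by exact: mcomputable_proj.
have Hc c : mcomputable (fun _ : 4.-tuple nat => c) by exact: mcomputable_const.
rewrite /code_input /code_input_eq.
by do ![apply: mcomputable_cpair => // | apply: mcomputable_code_nseq => //].
Qed.

Lemma input_sentence_occ n k m (p : wform 'I_n.+1 ('I_k + 'I_(4 + m))%type) d :
    (forall x, wform_occ x p <= 2) ->
    (forall i, wform_occ (inr (lshift m i)) p <= 1) ->
  ae_at_most_twice (input_sentence p d).
Proof.
move=> H2 H1 x; rewrite /input_sentence /=.
have -> : wform_occ x (foldr (fun i => WAnd (input_eq n k m i (tnth d i))) p (enum 'I_4)) =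
    \sum_i (inr (lshift m i) == x) + wform_occ x p.
  rewrite -big_enum /=; elim: (enum _) => [|i s IHs]; first by rewrite big_nil.
  by rewrite big_cons /= IHs addn0 addnA.
case: x => [u|j]; first by rewrite big1 // add0n; apply: H2.
have [i0 ->|e ->] := split_ordP j.
  apply: (@leq_add _ _ 1 1) => //; apply: (@sum_delta _ i0) => i.
  by rewrite muln1 -[inr _ == _]/(lshift m i == lshift m i0) (inj_eq (@lshift_inj _ _)).
rewrite big1 ?add0n // => i _.
by rewrite -[inr _ == _]/(lshift m i == rshift 4 e) eq_lrshift.
Qed.

Lemma input_sentence_holds n k m (p : wform 'I_n.+1 ('I_k + 'I_(4 + m))%type) d h :
  wform_holds h (ae_matrix (input_sentence p d)) <->
  (forall i, h (inr (lshift m i)) = nseq (tnth d i) ord0) /\ wform_holds h p.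
Proof.
rewrite /input_sentence /=.
have -> : (forall i : 'I_4, h (inr (lshift m i)) = nseq (tnth d i) ord0) <->
    (forall i, i \in enum 'I_4 -> h (inr (lshift m i)) = nseq (tnth d i) ord0).
  by split=> H i => [_|]; apply: H; rewrite ?mem_enum.
elim: (enum _) => [|i s IHs] /=; first by split=> [|[]].
rewrite IHs; split=> [[Hi [Hs Hp]]|[Hs Hp]].
  by split=> // j; rewrite inE => /predU1P[->|/Hs].
split; first by apply: Hs; rewrite mem_head.
by split=> // j js; apply: Hs; rewrite inE js orbT.
Qed.

(** * Letters and variables as ordinals *)

Section Transport.
Variables (Lam : finType) (pats : seq (seq (pitem Lam))).
Hypothesis pats_PA : {in pats, forall p, count_mem (PA Lam) p <= 2}.
Variables (wi : 'I_4 -> seq (option Lam)) (wm we : seq (option Lam)).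

Definition lcode (c : option Lam) : 'I_#|Lam|.+1 :=
  if c is Some l then lift ord0 (enum_rank l) else ord0.
Definition ldecode (c : 'I_#|Lam|.+1) : option Lam := omap enum_val (unlift ord0 c).

Lemma lcodeK : cancel lcode ldecode.
Proof.
case=> [l|]; rewrite /ldecode /lcode; first by rewrite liftK /= enum_rankK.
by rewrite unlift_none.
Qed.

Lemma ldecodeK : cancel ldecode lcode.
Proof.
move=> c; rewrite /ldecode; case: unliftP => [l ->|->] //=.
by rewrite enum_valK.
Qed.

Definition aux := (bool + 'I_(size pats) * pvar pats)%type.

(** The input variables go to the first four existential positions, where [input_eq] expects them;
    likewise [lcode] sends zero to [ord0]. *)
Definition vcode (v : var pats 4) : ('I_#|{: uvar pats}| + 'I_(4 + #|{: aux}|))%type :=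
  match v with
  | inl u => inl (enum_rank u)
  | inr (inl i) => inr (lshift _ i)
  | inr (inr e) => inr (rshift 4 (enum_rank e))
  end.

Definition edecode (j : 'I_(4 + #|{: aux}|)) : evar pats 4 :=
  match split j with inl i => inl i | inr e => inr (enum_val e) end.

Definition vdecode (v : ('I_#|{: uvar pats}| + 'I_(4 + #|{: aux}|))%type) : var pats 4 :=
  match v with inl u => inl (enum_val u) | inr j => inr (edecode j) end.

Lemma edecodeK (j : 'I_(4 + #|{: aux}|)) : vcode (inr (edecode j)) = inr j.
Proof.
rewrite /edecode; have [i ->|e ->] := split_ordP j => //=; by rewrite enum_valK.
Qed.

Lemma vdecodeK : cancel vdecode vcode.
Proof. by case=> [u|j]; rewrite ?edecodeK //= enum_valK. Qed.

Lemma vcodeK : cancel vcode vdecode.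
Proof.
case=> [u|[i|e]] /=; rewrite ?enum_rankK //; congr (inr _); rewrite /edecode.
  have [j /lshift_inj <-|j /eqP] := split_ordP (lshift #|{: aux}| i) => //.
  by rewrite eq_lrshift.
have [j /eqP|j /rshift_inj <-] := split_ordP (rshift 4 (enum_rank e)).
  by rewrite eq_rlshift.
by rewrite enum_rankK.
Qed.

Definition ord_form := wform_map lcode vcode (pats_form pats wi wm we).

Lemma ord_form_twice d : ae_at_most_twice (input_sentence ord_form d).
Proof.
have occ x : wform_occ x ord_form = wform_occ (vdecode x) (pats_form pats wi wm we).
  by rewrite -{1}(vdecodeK x) wform_map_occ //; apply: can_inj vcodeK.
have le := pats_form_occ pats_PA wi wm we.
apply: input_sentence_occ => [x|i]; rewrite occ.
  by apply: leq_trans (le _) _; case: (vdecode x) => [|[]].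
have -> : vdecode (inr (lshift _ i)) = inr (inl i) := vcodeK (inr (inl i)).
exact: (le (inr (inl i))).
Qed.

Lemma ord_form_valid (d : 4.-tuple nat) : ae_valid (input_sentence ord_form d) <->
  forall S, exists2 p, p \in pats & occurs p (whole wi wm we (tnth d) S).
Proof.
have zerosE n : nseq n ord0 = map lcode (zeros Lam n) by rewrite map_nseq.
have linj := can_inj lcodeK.
split=> [H S|/(pats_form_complete (wi := wi)) H X'].
- apply: (@pats_form_sound _ pats 4 wi wm we (tnth d) S) => X.
  have /= [Y' /input_sentence_holds[YT HY]] :=
    H (fun i : 'I_#|{: uvar pats}| => map lcode (X (enum_val i))).
  exists (fun e => map ldecode (if vcode (inr e) is inr j then Y' j else [::])); split.
    move=> i /=; rewrite YT zerosE -map_comp; apply: map_id_in => c _ /=.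
    exact: lcodeK.
  apply: (iffLR (@wform_map_holds _ _ _ _ _ _ linj _ _ _ _) HY) => -[u|[i|e]] /=.
    by rewrite enum_rankK.
    by rewrite -map_comp map_id_in // => c _ /=; apply: ldecodeK.
  by rewrite -map_comp map_id_in // => c _ /=; apply: ldecodeK.
- have [Y [YT HY]] := H (fun u => map ldecode (X' (enum_rank u))).
  exists (fun j => map lcode (Y (edecode j))); apply/input_sentence_holds.
  have ged e : vdecode (vcode (inr e)) = inr e by exact: vcodeK.
  split=> [i|].
    have := ged (inl i); rewrite /= => -[->]; by rewrite YT zerosE.
  apply: (iffRL (@wform_map_holds _ _ _ _ _ _ linj _ _ _ _) HY) => -[u|[i|e]] /=.
  + by rewrite -map_comp map_id_in // => c _ /=; apply: ldecodeK.
  + by have := ged (inl i); rewrite /= => -[->].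
  + by have := ged (inr e); rewrite /= => -[->].
Qed.

End Transport.

Lemma bad_pats_PA (Q : finType) K (T : rel Q) (constrs : Q -> seq constr) :
  {in bad_pats K T constrs, forall p, count_mem (PA _) p <= 2}.
Proof.
have cnt l0 pre ls lr post l1 :
    count_mem (PA (letter Q K)) (compare_pat l0 pre ls lr post l1) <= 2.
  rewrite /compare_pat /= !count_cat /= count_cat /= !count_cat /=.
  have -> : count_mem (PA (letter Q K)) (skips ls) = 0 by elim: ls.
  by case: pre => [c|]; case: post => [c'|].
move=> p /bad_patsP[[l [l' [_ ->]]] //|[q [q' [[[[i j] c] d] [_ _]]]]].
by rewrite !inE => /orP[]/eqP->; apply: cnt.
Qed.

(** * The initial configuration as a word around the input *)

Section HistoryWhole.
Variables (Q : finType) (K : nat) (q0 qf : Q).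

(** Register 0 is empty, so its letter directly precedes that of register 1; input [i] is the
    contents of register [i.+1]. *)
Definition wpre (i : 'I_4) : seq (option (letter Q K)) :=
  if val i == 0 then [:: Some (lett K q0 0); Some (lett K q0 1)]
  else [:: Some (lett K q0 i.+1)].
Definition wmid : seq (option (letter Q K)) :=
  [seq Some (lett K q0 i) | i <- iota 5 (K.+1 - 5)].
Definition wpost : seq (option (letter Q K)) := [:: Some (lett K qf 0)].

(** The default of [nth] makes the registers from 5 on empty, so their blocks are bare letters. *)
Lemma history_whole (d : 4.-tuple nat) S : 4 < K ->
  history q0 qf (nth 0 (0 :: d)) S = whole wpre wmid wpost (tnth d) S.
Proof.
move=> ltK; rewrite /history /whole /wmid /wpost.
have -> : iota 0 K = iota 0 5 ++ iota 5 (K - 5) by rewrite -iotaD subnKC.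
have -> : iota 5 (K.+1 - 5) = iota 5 (K - 5) ++ [:: K].
  by rewrite (_ : K.+1 - 5 = K - 5 + 1) ?iotaD ?subnKC //; lia.
rewrite map_cat enc_cat !map_cat.
have -> : enc [seq (lett K q0 i, nth 0 (0 :: d) i) | i <- iota 5 (K - 5)] =
    [seq Some (lett K q0 i) | i <- iota 5 (K - 5)].
  have : all (leq 5) (iota 5 (K - 5)) by apply/allP=> i; rewrite mem_iota => /andP[].
  elim: (iota 5 (K - 5)) => //= i s IHs /andP[le5 /IHs <-].
  by rewrite enc_cons /= nth_default //= size_tuple.
rewrite enum_ord4 /= /wpre /= !inordK // !(tnth_nth 0) !inordK //.
by rewrite /enc /= !cats0 -?catA /= -?catA /= -?catA /= -?catA /= -?catA.
Qed.
End HistoryWhole.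

Lemma mcomputes_comp1 k (f : mrec 1) (g : mrec k) (G : k.-tuple nat -> nat) v s :
    (forall w, mcomputes g w (G w)) ->
  mcomputes (MComp f (fun=> g)) v s <-> mcomputes f [tuple G v] s.
Proof.
move=> Hg; split=> [[w gw fw]|fs].
  suff <- : w = [tuple G v] by [].
  apply: eq_from_tnth => i; rewrite [RHS](tnth_nth 0) ord1 /=.
  exact: mcomputes_fun (gw _) (Hg v).
by exists [tuple G v] => // i; rewrite (tnth_nth 0) ord1.
Qed.

(** The result goes to register 5; decrementing it and testing it against register 0 accepts exactly
    the value 1. *)
Definition accept_one (f : mrec 4) : cmd :=
  cseq [:: compile f [tuple 1; 2; 3; 4] 5 6;
           CAtom (ASet 5 5 true false); CAtom (ATest 5 0)].

Lemma accept_oneP f (d : 4.-tuple nat) :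
  (exists m, exec (accept_one f) (nth 0 (0 :: d)) m) <-> mcomputes f d 1.
Proof.
have [] := @compileP _ f [tuple 1; 2; 3; 4] 5 6 (nth 0 (0 :: d)) => //.
have -> : [tuple of map (nth 0 (0 :: d)) [tuple 1; 2; 3; 4]] = d.
  by apply: val_inj; case: d => -[|a [|b [|c [|e [|]]]]] //.
move=> H1 H2; split.
  case=> m /exec_seq[m1 /H1[v fv [e1 e2]]].
  case/exec_seq=> m2 /exec_atom /= [e3 e4] /exec_seq[m3 /exec_atom /= [e5 e6] _].
  have m10 : m1 0 = 0 by rewrite e2.
  have v1 : v = 1 by rewrite (e4 0) // m10 in e5; lia.
  by rewrite v1 in fv.
case/H2=> m1 ex1 [e1 e2].
have m10 : m1 0 = 0 by rewrite e2.
exists (upd m1 5 0); apply/exec_seq; exists m1 => //.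
apply/exec_seq; exists (upd m1 5 0); first by apply: ExAtom; apply: atom_upd; rewrite e1.
apply/exec_seq; exists (upd m1 5 0); last exact: exec_cskip.
by apply: ExAtom; rewrite /= /upd /= m10.
Qed.

Theorem theorem2 : ~ mu_decidable_on code_ae ae_at_most_twice ae_valid.
Proof.
case=> f Hf; have [g Hg] := mcomputable_code_input.
pose F := MComp f (fun=> g); pose c := accept_one F.
(* The bound 5 ensures that register 0 and the four input registers are recorded. *)
pose K := maxn (cbound c) 5.
have cK : cbound c <= K by apply: leq_maxl.
have K5 : 4 < K by apply: leq_maxr.
have K0 : 0 < K by lia.
have [q0 q0E] : exists q, @pstate c q = [:: c; cskip].
  by apply: pstate_surj; rewrite mem_cat conts_head.
have [qf qfE] : exists q, @pstate c q = [::].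
  by apply: pstate_surj; rewrite mem_cat !inE !orbT.
pose T := @pstep c; pose constrs := @pconstr c K.
have Tneq : forall q q', T q q' -> q != q' by exact: pstep_neq.
have consb q : all (fun e : constr => (e.1.1.1 < K) && (e.1.1.2 < K)) (constrs q).
  by apply: head_constr_bound; apply: pstates_bound (pstate_in _).
pose pats := bad_pats K T constrs.
pose phi := ord_form pats (@wpre _ K q0) (@wmid _ K q0) (@wpost _ K qf).
pose d := description phi.
pose s := input_sentence phi d.
have sE : code_ae s = code_input d by rewrite /s -code_inputE.
have s2 : ae_at_most_twice s by apply: ord_form_twice; apply: bad_pats_PA.
have acc : mcomputes F d 1 <-> machine_run T constrs K q0 qf (nth 0 (0 :: d)).
  rewrite -accept_oneP; apply: program_run => // l leK.
  by rewrite nth_default // (leq_trans K5).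
have [Hv Hn] := Hf s s2; rewrite sE in Hv Hn.
have FE v := @mcomputes_comp1 _ f g _ d v Hg.
(* If the sentence were true, [F] would give 1 on [d] and there would be an accepting run; but the
   history of that run contains no error. *)
have nv : ~ ae_valid s.
  move=> sv; have /FE/acc := Hv sv.
  case=> n [qs [x [e0 en HT Hc Hx]]].
  have n0 : 0 < n.
    by case: n en {HT Hc} => // en; move: qfE; rewrite -en e0 q0E.
  have [S nocc] := history_of_run Tneq consb HT Hc Hx n0.
  have /ord_form_valid /(_ S)[p inp] := sv.
  by rewrite -history_whole // -e0 -en; apply: nocc.
(* The sentence being false, [F] gives 0, so there is no accepting run. *)
have nacc : ~ machine_run T constrs K q0 qf (nth 0 (0 :: d)).
  move=> /acc F1; have /FE F0 := Hn nv.
  by have := mcomputes_fun F1 F0.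
(* A word [S] without error would yield an accepting run; so every [S] contains one and the sentence
   is true after all. *)
apply: nv; apply/ord_form_valid => S; apply: NNPP => nocc.
apply: nacc; apply: (@run_of_history _ K T constrs consb q0 qf _ S) => p inp occ.
by apply: nocc; exists p => //; rewrite -history_whole.
Qed.
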